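(* In the Markov modulated model for $n$ obligors described in the context, for $0\le s\le t$ and $0\le k\le n$ let $\zeta^k_{t|s}=\mathbb E[\mathbf 1_{\{N_t=k\}}X_t\mid\mathcal F_s]$ and $\zeta^k_s=\mathbf 1_{\{N_s=k\}}X_s$. Then $$\zeta^k_{t|s}=\sum_{j=0}^k\binom{n-j}{k-j}\sum_{i=0}^k(-1)^{k-i}\binom{k-j}{k-i}\exp\big(Q_{(n-i)\lambda}(t-s)\big)\,\zeta^j_s,$$ where $Q_{k\lambda}=Q-k\,\mathrm{diag}(\lambda)$ for $k\ge0$.
   Context: Model. $X$ is a continuous-time Markov chain with values in the set $\{e_1,\dots,e_d\}$ of standard basis vectors of $\mathbb R^d$, with irreducible transition matrix $Q\in\mathbb R^{d\times d}$; convention: $Q_{ij}$, $i\neq j$, is the intensity of a transition from state $j$ to state $i$, so column sums of $Q$ are zero and $\mathrm dX_t=QX_t\,\mathrm dt+\mathrm dM^X_t$ with $M^X$ a martingale. Let $\lambda\in\mathbb R^d_+$. There are $n$ default times $\tau^1,\dots,\tau^n$ which, conditionally on the whole process $X$, are independent with $\mathbb P(\tau^i>t\mid\mathcal F^X)=\exp(-\int_0^t\lambda^\top X_s\,\mathrm ds)$. Put $Y^i_t=\mathbf 1_{\{\tau^i\le t\}}$ and $N_t=\sum_{i=1}^nY^i_t$ (so $N_0=0$). Then $\mathrm dN_t=\lambda^\top X_t(n-N_t)\,\mathrm dt+\mathrm dm_t$ with $m$ a martingale, and $X$ and $N$ have a.s. no simultaneous jumps. $(\mathcal F_t)$ is the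 filtration generated by $X$ and $Y^1,\dots,Y^n$. $\mathrm{diag}(\lambda)$ is the diagonal matrix with diagonal $\lambda$. Binomial coefficients $\binom ab$ with $b>a\ge0$ are zero. *)

(* Defs.v *)
From HB Require Import structures.
From mathcomp Require Import all_boot all_order all_algebra.
From mathcomp Require Import all_classical all_reals all_analysis.
From mathcomp Require Import measurable_realfun.
Set Implicit Arguments.
Unset Strict Implicit.
Unset Printing Implicit Defensive.
Import Order.TTheory GRing.Theory Num.Theory.
Import numFieldNormedType.Exports.
Local Open Scope classical_set_scope.
Local Open Scope ring_scope.

Definition expmx (R : realType) (d : nat) (A : 'M[R]_d) : 'M[R]_d :=
  limn (series (fun k => (k`!%:R)^-1 *: A ^+ k)).

Section Probability.
Context {R : realType} {disp : measure_display} {T : measurableType disp}.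
Variable P : probability T R.

(* [Z] is a version of E[W | G]; [G] is intended to be a sub-sigma-algebra. *)
Definition is_condexp (G : set_system T) (W Z : T -> R) : Prop :=
  [/\ P.-integrable setT (EFin \o W),
      P.-integrable setT (EFin \o Z),
      (forall B : set R, measurable B -> G (Z @^-1` B)) &
      forall A : set T, G A ->
        \int[P]_(w in A) (Z w)%:E = \int[P]_(w in A) (W w)%:E]%E.

Definition is_condexp_cV d (G : set_system T) (W Z : T -> 'cV[R]_d) : Prop :=
  forall i, is_condexp G (fun w => W w i 0) (fun w => Z w i 0).

(* Subfamilies are covered by taking some of the [B i] to be [setT]. *)
Definition cond_independent (n : nat) (G : set_system T)
    (tau : 'I_n -> T -> \bar R) : Prop :=
  forall (B : 'I_n -> set (\bar R)) (p : 'I_n -> T -> R),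
    (forall i, measurable (B i)) ->
    (forall i, is_condexp G \1_(tau i @^-1` B i) (p i)) ->
    is_condexp G \1_(\bigcap_i (tau i @^-1` B i)) (fun w => \prod_i p i w).

End Probability.

(* sigma-algebra generated by the real random variables [Z i u], i : I, u in D *)
Definition sigma_process (R : realType) (disp : measure_display)
    (T : measurableType disp) (I : Type) (Z : I -> R -> T -> R) (D : set R)
    : set_system T :=
  <<s \bigcup_(p in [set p : I * R | D p.2])
        preimage_set_system setT (Z p.1 p.2) measurable >>.

Section Generators.
Context {R : realType} {d : nat}.

(* Column convention: [Q i j] is the intensity of a transition from j to i. *)
Definition intensity_matrix (Q : 'M[R]_d) : Prop :=
  (forall i j, i != j -> 0 <= Q i j) /\ (forall j, \sum_i Q i j = 0).

Definition irreducible_intensity (Q : 'M[R]_d) : Prop :=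
  forall i j, connect (fun a b => (a != b) && (0 < Q b a)) i j.

Definition stochastic_semigroup (Pt : R -> 'M[R]_d) : Prop :=
  [/\ Pt 0 = 1%:M,
      (forall s t, 0 <= s -> 0 <= t -> Pt (s + t) = Pt s *m Pt t),
      (forall t i j, 0 <= t -> 0 <= Pt t i j) &
      (forall t j, 0 <= t -> \sum_i Pt t i j = 1)].

Definition has_intensities (Pt : R -> 'M[R]_d) (Q : 'M[R]_d) : Prop :=
  h^-1 *: (Pt h - 1%:M) @[h --> 0^'+] --> Q.

(* Q_{k lambda} = Q - k diag(lambda) *)
Definition Qlam (Q : 'M[R]_d) (lam : 'cV[R]_d) (k : nat) : 'M[R]_d :=
  Q - k%:R *: diag_mx lam^T.

End Generators.

Section Processes.
Context {R : realType} {disp : measure_display} {T : measurableType disp}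
        {d n : nat}.
Variables (P : probability T R).
Variables (Q : 'M[R]_d) (lam : 'cV[R]_d).
Variables (X : R -> T -> 'cV[R]_d) (tau : 'I_n -> T -> \bar R).

(* Only times t >= 0 matter; the values [X t] for t < 0 are irrelevant. *)

Definition FX (D : set R) : set_system T :=
  sigma_process (fun (i : 'I_d) t w => X t w i 0) D.

Definition cadlag (x : R -> 'cV[R]_d) : Prop :=
  (forall t, 0 <= t -> x u @[u --> t^'+] --> x t) /\
  (forall t, 0 < t -> cvg (x u @[u --> t^'-])).

(* Since [X t] is a basis vector, the i-th coordinate of the last clause reads
   P(X_t = e_i | F^X_s) = (Pt (t - s) X_s)_i. *)
Definition markov_chain : Prop :=
  [/\ (forall t i, 0 <= t -> measurable_fun setT (fun w => X t w i 0)),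
      (forall t w, 0 <= t -> exists i, X t w = delta_mx i 0),
      (forall w, cadlag (X ^~ w)) &
      exists Pt : R -> 'M[R]_d,
        [/\ stochastic_semigroup Pt, has_intensities Pt Q &
            forall s t, 0 <= s <= t ->
              is_condexp_cV P (FX `[0, s]) (X t)
                (fun w => Pt (t - s) *m X s w)]].

Definition cum_intensity (t : R) (w : T) : R :=
  \int[lebesgue_measure]_(u in `[0, t]) (lam^T *m X u w) 0 0.

Definition default_times : Prop :=
  [/\ (forall i, measurable_fun setT (tau i)),
      (forall i w, 0 <= tau i w)%E,
      (forall i t, 0 <= t ->
         is_condexp P (FX `[0, +oo[) \1_[set w | t%:E < tau i w]%E
           (fun w => expR (- cum_intensity t w))) &
      cond_independent P (FX `[0, +oo[) tau].

Definition Y (i : 'I_n) (t : R) (w : T) : nat := (tau i w <= t%:E)%E.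

Definition N (t : R) (w : T) : nat := \sum_i Y i t w.

Definition filtration (s : R) : set_system T :=
  sigma_process (fun z : 'I_d + 'I_n => match z with
    | inl i => fun t w => X t w i 0
    | inr i => fun t w => (Y i t w)%:R
    end) `[0, s].

Definition zeta (k : nat) (t : R) (w : T) : 'cV[R]_d :=
  (N t w == k)%:R *: X t w.

End Processes.

(* Main.v *)
Require Import Defs.
From HB Require Import structures.
From mathcomp Require Import all_boot all_order all_algebra.
From mathcomp Require Import all_classical all_reals all_analysis.
From mathcomp Require Import measurable_realfun.
From mathcomp Require Import ring lra zify.
Import Order.TTheory GRing.Theory Num.Theory.
Import numFieldNormedType.Exports.
Local Open Scope classical_set_scope.
Local Open Scope ring_scope.

(**
  For a set [D] of obligors let [S_D(t)] be the indicator that all of them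
  survive until [t].  The theorem is a linear combination of the identities
  [E[S_D(t) X_t | F_s] = exp((t - s) Q_{|D| lambda}) S_D(s) X_s]: the sum of
  [S_D] over the sets [D] of size [n - i] is the binomial coefficient
  [C(n - N, n - i)], and [1_{N = k}] is recovered from these by inversion.

  By conditional independence the identity for [S_D] reduces, on a pi-system
  generating [F_s], to the Feynman-Kac formula
  [E[exp(- m (L_t - L_s)) X_t | F^X_s] = exp((t - s) Q_{m lambda}) X_s], where
  [L] is the cumulated intensity.  Replacing [L_t - L_s] by a Riemann sum with
  right endpoints and mesh [h = (t - s) / N], the Markov property turns the
  left-hand side into the power [(D_h P_h)^N], with [P] the transition
  semigroup and [D_h = exp(- m h diag(lambda))]; since
  [D_h P_h = 1 + h Q_{m lambda} + o(h)], it converges to the exponential.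
*)

(** * The matrix exponential as a limit of powers *)

Lemma cvg_mx_coord {R : realType} {m n : nat} {U : Type} {F : set_system U}
    {FF : Filter F} (f : U -> 'M[R]_(m, n)) (A : 'M[R]_(m, n)) :
  (forall i j, f x i j @[x --> F] --> A i j) -> f x @[x --> F] --> A.
Proof.
move=> fA; apply/cvg_ballP => e e0.
have : \forall x \near F, forall ij : 'I_m * 'I_n,
    ball (A ij.1 ij.2) e (f x ij.1 ij.2).
  by apply: filter_forall => -[i j] /=; move/cvg_ballP: (fA i j) => /(_ e e0).
by apply: filterS => x H; split=> // i j; exact: H (i, j).
Qed.

Lemma cvg_sumr {R : realType} {U : Type} {F : set_system U} {FF : Filter F}
    {I : Type} (r : seq I) (f : I -> U -> R) (l : I -> R) :
  (forall i, f i x @[x --> F] --> l i) ->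
  \sum_(i <- r) f i x @[x --> F] --> \sum_(i <- r) l i.
Proof.
by move=> fl; apply: cvg_big => //; exact: add_continuous.
Qed.

(** Dominated convergence for series. Beyond a fixed [K] both [f N] and [l] are controlled by the
    tail of [g], and the first [K] terms converge as a finite sum. The cut-off [u N] accommodates
    finite expansions of growing length. *)
Lemma tannery {R : realType} {f : nat -> nat -> R} {l g : nat -> R}
    {u : nat -> nat} :
  u N @[N --> \oo] --> \oo ->
  cvgn (series g) -> (forall N k, `|f N k| <= g k) ->
  (forall k, f N k @[N --> \oo] --> l k) ->
  cvgn (series l) /\
  \sum_(0 <= k < u N) f N k @[N --> \oo] --> limn (series l).
Proof.
move=> uoo cg fg fl.
have lg k : `|l k| <= g k.
  have fnl : `|f N k| @[N --> \oo] --> `|l k| by exact: cvg_norm.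
  rewrite -(cvg_lim _ fnl)//; apply: limr_le; first exact: cvgP fnl.
  by near=> N; exact: fg.
have cl : cvgn (series l).
  apply: normed_cvg; apply: series_le_cvg cg => // k; first exact: normr_ge0.
  exact: le_trans (normr_ge0 _) (lg k).
split=> //.
suff d0 : \sum_(0 <= k < u N) f N k - series l (u N) @[N --> \oo] --> (0 : R).
  rewrite -[limn _]add0r (_ : (fun N => _) = (fun N =>
    (\sum_(0 <= k < u N) f N k - series l (u N)) + series l (u N))); last first.
    by apply/funext => N; rewrite subrK.
  by apply: (cvgD d0); exact: cvg_comp uoo cl.
apply/cvgrPdist_le => e e0.
have e4 : 0 < e / 4 by rewrite divr_gt0.
have /cvg_cauchy/cauchy_seriesP/(_ _ e4) := cg.
case=> -[B1 B2] /= [[K1 _ BK1] [K2 _ BK2]] tailg.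
(* From [K] on the tail of [g] is below [e / 4], and it counts twice because
   [|f N k - l k| <= g k + g k]; the head takes another [e / 4]. *)
pose K := maxn K1 K2.
have tl N : (K <= N)%N -> \sum_(K <= k < N) g k < e / 4.
  move=> KN; apply: le_lt_trans (ler_norm _) _.
  apply: (tailg (K, N)); split => /=.
    by apply: BK1 => /=; exact: leq_maxl.
  by apply: BK2 => /=; apply: leq_trans KN; exact: leq_maxr.
have hd : \sum_(0 <= k < K) `|f N k - l k| @[N --> \oo] --> (0 : R).
  rewrite -[X in _ --> X](_ : \sum_(0 <= k < K) `|l k - l k| = 0); last first.
    by rewrite big1// => i _; rewrite subrr normr0.
  apply: cvg_sumr => k.
  by apply: cvg_norm; apply: cvgB; [exact: fl|exact: cvg_cst].
have /cvgrPdist_lt/(_ _ e4) hd4 := hd.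
near=> N.
have KN : (K <= u N)%N by near: N; exact: (uoo _ (nbhs_infty_ge K)).
rewrite sub0r normrN /series/= -sumrB (big_cat_nat _ KN)//=.
have h1 : `|\sum_(0 <= i < K) (f N i - l i)| <= e / 4.
  apply: le_trans (ler_norm_sum _ _ _) _.
  rewrite -[leLHS]ger0_norm ?sumr_ge0// -normrN -sub0r ltW//.
  by near: N.
have h2 : `|\sum_(K <= i < u N) (f N i - l i)| <= e / 4 + e / 4.
  apply: le_trans (ler_norm_sum _ _ _) _.
  apply: (@le_trans _ _ (\sum_(K <= i < u N) (g i + g i))).
    by apply: ler_sum => i _; apply: le_trans (ler_normB _ _) _; exact: lerD.
  by rewrite big_split lerD// ltW// tl.
apply: le_trans (ler_normD _ _) _.
apply: le_trans (lerD h1 h2) _.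
rewrite [leRHS](_ : e = e / 4 + (e / 4 + (e / 4 + e / 4))); last by field.
by rewrite lerD2l lerD2l lerDl ltW.
Unshelve. all: by end_near.
Qed.

(** Passing from [k] to [k + 1] multiplies the ratio by [(N + 1 - k) / (N + 1)], which tends to
    1. *)
Lemma cvg_ffact_ratio (R : realType) (k : nat) :
  ((N.+1 ^_ k)%:R / N.+1%:R ^+ k : R) @[N --> \oo] --> (1 : R).
Proof.
elim: k => [|k IH].
  by under eq_fun do rewrite ffactn0 expr0 divr1; exact: cvg_cst.
have h1 : ((N.+1 - k)%:R / N.+1%:R : R) @[N --> \oo] --> (1 : R).
  have : 1 - k%:R * (N.+1%:R)^-1 @[N --> \oo] --> (1 - k%:R * 0 : R).
    apply: cvgB; first exact: cvg_cst.
    by apply: cvgM; [exact: cvg_cst|exact: cvg_harmonic].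
  rewrite mulr0 subr0; apply: cvg_trans; apply: near_eq_cvg.
  near=> N; rewrite natrB; first by rewrite mulrBl divff ?pnatr_eq0.
  by apply: leqW; near: N; exact: nbhs_infty_ge.
rewrite (_ : (fun N => _) = (fun N => ((N.+1 ^_ k)%:R / N.+1%:R ^+ k) *
   ((N.+1 - k)%:R / N.+1%:R) : R)); last first.
  by apply/funext => N; rewrite ffactnSr natrM exprSr invfM mulrACA.
by rewrite -[X in _ --> X]mulr1; exact: cvgM.
Unshelve. all: by end_near.
Qed.

Section MatrixExponential.
Context {R : realType} {d : nat}.
Implicit Types (A : 'M[R]_d) (E : nat -> 'M[R]_d).

Lemma mx_expS A k i j : (A ^+ k.+1) i j = \sum_l A i l * (A ^+ k) l j.
Proof. by rewrite exprS mxE. Qed.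

Lemma mx_expZ (a : R) A k : (a *: A) ^+ k = a ^+ k *: A ^+ k.
Proof.
elim: k => [|k IH]; first by rewrite !expr0 scale1r.
rewrite exprS IH; transitivity ((a *: A) *m (a ^+ k *: A ^+ k)) => //.
by rewrite -scalemxAl -scalemxAr scalerA -exprS [A ^+ k.+1]exprS.
Qed.

(** Here [c] bounds the largest absolute row sum, a submultiplicative norm: splitting off the left
    factor, its row sum absorbs one [c]. *)
Lemma mx_exp_bound {A} {c : R} : (forall i, \sum_j `|A i j| <= c) ->
  forall k i j, `|(A ^+ k) i j| <= c ^+ k.
Proof.
move=> Ac; elim=> [|k IH] i j.
  by rewrite !expr0 mxE normr_nat; case: eqP.
have c0 : 0 <= c by apply: le_trans (Ac i); exact: sumr_ge0.
rewrite mx_expS; apply: le_trans (ler_norm_sum _ _ _) _.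
apply: (@le_trans _ _ (\sum_l `|A i l| * c ^+ k)).
  by apply: ler_sum => l _; rewrite normrM ler_wpM2l.
by rewrite -mulr_suml exprS ler_wpM2r// exprn_ge0.
Qed.

Lemma cvg_mx_exp {U : Type} {F : set_system U} {FF : Filter F}
    {f : U -> 'M[R]_d} {A} : (forall i j, f x i j @[x --> F] --> A i j) ->
  forall k i j, (f x ^+ k) i j @[x --> F] --> (A ^+ k) i j.
Proof.
move=> fA; elim=> [|k IH] i j; first exact: cvg_cst.
rewrite mx_expS; under eq_fun do rewrite mx_expS.
by apply: cvg_sumr => l; exact: cvgM.
Qed.

(* The binomial expansion of [(1 + E N) ^+ N.+1] has k-th term
   [(N.+1 ^_ k / N.+1 ^ k) / k! * (N.+1 * E N) ^+ k], and Tannery's theorem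
   allows passing to the limit term by term. *)
Lemma expmx_lim_pow {E A} :
  (forall i j, N.+1%:R * E N i j @[N --> \oo] --> A i j) ->
  forall i j, ((1 + E N) ^+ N.+1) i j @[N --> \oo] --> expmx A i j.
Proof.
move=> EA.
pose B N := N.+1%:R *: E N.
have BA i j : B N i j @[N --> \oo] --> A i j.
  by under eq_fun do rewrite mxE; exact: EA.
(* The sum of all absolute entries of [B N] converges, hence is bounded in [N], and it dominates
   every row sum. *)
have [c Bc] : exists c : R, forall N i, \sum_j `|B N i j| <= c.
  have cB : \sum_i \sum_j `|B N i j| @[N --> \oo] --> \sum_i \sum_j `|A i j|.
    by do 2 (apply: cvg_sumr => ?); exact: cvg_norm.
  have [M [_ /(_ (M + 1))]] := cvg_seq_bounded (cvgP _ cB).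
  rewrite ltrDl => /(_ ltr01) bM; exists (M + 1) => N i.
  apply: le_trans (bM N I); rewrite ger0_norm; last by do 2 apply: sumr_ge0 => ? _.
  by rewrite [leRHS](bigD1 i)//= lerDl; do 2 apply: sumr_ge0 => ? _.
pose f i j N k : R := ((N.+1 ^_ k)%:R / N.+1%:R ^+ k) *
  ((k`!%:R)^-1 * (B N ^+ k) i j).
have fg i j N k : `|f i j N k| <= exp_coeff c k.
  have c0 : 0 <= c by apply: le_trans (Bc N i); exact: sumr_ge0.
  rewrite /f/= normrM ger0_norm ?divr_ge0//.
  have H : `|k`!%:R^-1 * (B N ^+ k) i j| <= c ^+ k / k`!%:R.
    rewrite normrM ger0_norm ?invr_ge0// mulrC.
    apply: ler_wpM2r; first by rewrite invr_ge0.
    exact: mx_exp_bound.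
  (* The falling factorial is at most the power, so the ratio in [f] does not exceed 1. *)
  apply: le_trans H; rewrite -[leRHS]mul1r ler_wpM2r//.
  rewrite ler_pdivrMr ?exprn_gt0// mul1r -natrX ler_nat.
  elim: k => [|k IH]; first by rewrite ffactn0.
  by rewrite ffactnSr expnSr leq_mul// leq_subr.
pose l i j k : R := (k`!%:R)^-1 * (A ^+ k) i j.
have fl i j k : f i j N k @[N --> \oo] --> l i j k.
  rewrite -[l _ _ _]mul1r; apply: cvgM; first exact: cvg_ffact_ratio.
  by apply: cvgM; [exact: cvg_cst|exact: cvg_mx_exp].
(* The exponent is [N.+1], so the binomial expansion has [N.+2] terms. *)
have u2 : N.+2 @[N --> \oo] --> \oo.
  exact: (cvg_addnl 2).
have tan i j := tannery u2 (is_cvg_series_exp_coeff c) (fg i j) (fl i j).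
have sumE N i j : ((1 + E N) ^+ N.+1) i j = \sum_(0 <= k < N.+2) f i j N k.
  rewrite addrC exprD1n summxE big_mkord; apply: eq_bigr => k _.
  rewrite mulmxnE /f /B mx_expZ mxE -[LHS]mulr_natl.
  rewrite -bin_ffact natrM !mulrA; congr (_ * _).
  by rewrite mulrAC divfK ?expf_neq0 ?pnatr_eq0// mulfK// pnatr_eq0 -lt0n fact_gt0.
have expE i j : expmx A i j = limn (series (l i j)).
  rewrite /expmx.
  suff -> : limn (series (fun k => (k`!%:R)^-1 *: A ^+ k)) =
    \matrix_(i, j) limn (series (l i j)) by rewrite mxE.
  apply: cvg_lim; first exact: norm_hausdorff.
  apply: cvg_mx_coord => a b; rewrite mxE.
  rewrite (_ : (fun x => _) = series (l a b)); last first.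
    apply/funext => N; rewrite /series/= summxE.
    by apply: eq_bigr => k _; rewrite mxE.
  by case: (tan a b).
move=> i j; rewrite expE; under eq_fun do rewrite sumE.
by case: (tan i j).
Qed.
(** An instance of [expmx_lim_pow] in which every power is 1. It serves the case [s = t] of the
    Feynman-Kac formula. *)
Lemma expmx0 : expmx (0 : 'M[R]_d) = 1.
Proof.
apply/matrixP => i j.
have E0 a b : N.+1%:R * (0 : 'M[R]_d) a b @[N --> \oo] --> (0 : 'M[R]_d) a b.
  by rewrite mxE; under eq_fun do rewrite mulr0; exact: cvg_cst.
have := @expmx_lim_pow (fun=> 0) 0 E0 i j.
rewrite addr0 (_ : (fun=> _) = fun=> (1 : 'M[R]_d) i j); last first.
  by apply/funext => N; rewrite expr1n.
by move=> /(cvg_unique _ (cvg_cst _)) <-.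
Qed.

End MatrixExponential.

(** * Conditional expectations *)

Section SubSigmaAlgebra.
Context {R : realType} {disp : measure_display} {T : measurableType disp}.
Implicit Types (C : set_system T) (f : T -> R).

(** Links the preimage clause of [is_condexp] to [measurable_fun] over [g_sigma_algebraType C], so
    that the closure properties of measurable functions apply to sub-sigma-algebras. *)
Lemma g_sigma_measurable_funE C f :
  measurable_fun setT (f : g_sigma_algebraType C -> R) <->
  (forall B : set R, measurable B -> <<s C >> (f @^-1` B)).
Proof.
split=> [mf B mB|mf _ B mB]; last by rewrite setTI; exact: mf.
by rewrite -[X in <<s C >> X]setTI; exact: mf.
Qed.

Lemma g_sigma_sub_measurable {C} : C `<=` measurable -> <<s C >> `<=` measurable.
Proof. by apply: smallest_sub; exact: sigma_algebra_measurable. Qed.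

Lemma g_sigma_measurable_funW {C f} : C `<=` measurable ->
  measurable_fun setT (f : g_sigma_algebraType C -> R) ->
  measurable_fun setT f.
Proof.
move=> /g_sigma_sub_measurable Cm mf _ B mB; apply: Cm; exact: mf.
Qed.

Lemma g_sigma_measurable_fun_sub {C1 C2 f} : C1 `<=` <<s C2 >> ->
  measurable_fun setT (f : g_sigma_algebraType C1 -> R) ->
  measurable_fun setT (f : g_sigma_algebraType C2 -> R).
Proof.
move=> C12 mf _ B mB.
have /(_ (setT `&` f @^-1` B)) := @smallest_sub _ _ C1 _
  (smallest_sigma_algebra setT C2) C12.
by apply; exact: mf.
Qed.

Lemma g_sigma_measurable_indic {C} {A : set T} : <<s C >> A ->
  measurable_fun setT (\1_A : g_sigma_algebraType C -> R).
Proof. by move=> CA; exact: (@measurable_indic _ (g_sigma_algebraType C)). Qed.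

End SubSigmaAlgebra.

Lemma Rintegral_sum {R : realType} {disp : measure_display}
    {T : measurableType disp} (mu : measure T R) (D : set T) (I : Type)
    (r : seq I) (F : I -> T -> R) : measurable D ->
  (forall i, mu.-integrable D (EFin \o F i)) ->
  \int[mu]_(w in D) (\sum_(i <- r) F i w) = \sum_(i <- r) \int[mu]_(w in D) F i w.
Proof.
move=> mD Fi; elim: r => [|i r IH].
  under eq_Rintegral do rewrite big_nil.
  by rewrite Rintegral_cst// mul0r big_nil.
rewrite big_cons -IH -RintegralD//.
  by apply: eq_Rintegral => w _; rewrite big_cons.
rewrite (_ : _ \o _ = fun w => (\sum_(j <- r) (F j w)%:E)%E).
  by apply: integrable_sum => // j _; exact: Fi.
by apply/funext => w /=; rewrite sumEFin.
Qed.

(** The constant [c] is integrable on a set of finite measure and dominates the sequence. The limit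
    inherits the bound, whence its integrability. *)
Lemma Rintegral_bounded_cvg {R : realType} {disp : measure_display}
    {T : measurableType disp} (mu : measure T R) (D : set T) (f_ : nat -> T -> R)
    (f : T -> R) (c : R) : measurable D -> (mu D < +oo)%E ->
  (forall n, measurable_fun D (f_ n)) ->
  (forall n x, D x -> `|f_ n x| <= c) ->
  (forall x, D x -> f_ n x @[n --> \oo] --> f x) ->
  mu.-integrable D (EFin \o f) /\
  \int[mu]_(x in D) f_ n x @[n --> \oo] --> \int[mu]_(x in D) f x.
Proof.
move=> mD muD mf_ f_c f_f.
have mf : measurable_fun D f by exact: measurable_fun_cvg f_f.
have fc x : D x -> `|f x| <= c.
  move=> Dx; have fx : `|f_ n x| @[n --> \oo] --> `|f x|.
    by apply: cvg_norm; exact: f_f.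
  rewrite -(cvg_lim _ fx)//; apply: limr_le; first exact: cvgP fx.
  by near=> n; exact: f_c.
have bi (g : T -> R) : measurable_fun D g -> (forall x, D x -> `|g x| <= c) ->
    mu.-integrable D (EFin \o g).
  move=> mg gc; apply: measurable_bounded_integrable => //.
  exists c; split; first exact: num_real.
  by move=> M cM x Dx /=; apply: le_trans (gc _ Dx) (ltW cM).
have fi := bi _ mf fc; split=> //.
have : (\int[mu]_(x in D) (f_ n x)%:E @[n --> \oo] -->
    \int[mu]_(x in D) (f x)%:E)%E.
  apply: (@dominated_cvg _ _ _ _ _ _ _ _ (EFin \o cst c)) => //.
  - by move=> n; exact/measurable_EFinP.
  - by move=> x Dx; apply: cvg_EFin; [exact: nearW|exact: f_f].
  - by apply: measurable_bounded_integrable => //; exact: bounded_cst.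
have -> : (\int[mu]_(x in D) (f x)%:E)%E = (\int[mu]_(x in D) f x)%:E.
  by rewrite /Rintegral fineK// (integrable_fin_num _ fi).
by move/fine_cvg.
Unshelve. all: by end_near.
Qed.

Section ConditionalExpectation.
Context {R : realType} {disp : measure_display} {T : measurableType disp}.
Context {P : probability T R}.
Implicit Types (C : set_system T) (f g W Z H : T -> R).

Lemma bounded_integrable f (c : R) : measurable_fun setT f ->
  (forall w, `|f w| <= c) -> P.-integrable setT (EFin \o f).
Proof.
move=> mf fc; apply: (@le_integrable _ _ _ P setT _ _ (EFin \o cst c)) => //.
- exact/measurable_EFinP.
- by move=> w _ /=; rewrite lee_fin; apply: le_trans (fc w) (ler_norm _).
- exact: finite_measure_integrable_cst.
Qed.

Lemma integrableM_bounded f H (c : R) : measurable_fun setT H ->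
  (forall w, `|H w| <= c) -> P.-integrable setT (EFin \o f) ->
  P.-integrable setT (EFin \o (fun w => H w * f w)).
Proof.
move=> mH Hc fi.
have ci : P.-integrable setT (fun w => c%:E * (f w)%:E)%E by exact: integrableZl.
apply: le_integrable ci => //.
  apply/measurable_EFinP; apply: measurable_funM => //.
  by apply/measurable_EFinP; exact: measurable_int fi.
move=> w _ /=; rewrite lee_fin !normrM ler_wpM2r//.
by apply: le_trans (Hc w) (ler_norm _).
Qed.

Lemma integral_Rintegral f (A : set T) : measurable A ->
  P.-integrable setT (EFin \o f) ->
  (\int[P]_(w in A) (f w)%:E)%E = (\int[P]_w (\1_A w * f w))%:E.
Proof.
move=> mA fi.
have fiA : P.-integrable A (EFin \o f) by exact: integrableS fi.
transitivity (\int[P]_(w in A) f w)%:E.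
  by rewrite /Rintegral fineK// (integrable_fin_num _ fiA).
congr (_%:E); rewrite Rintegral_mkcond; apply: eq_Rintegral => w _.
by rewrite patch_indic /= mulrC.
Qed.

(** Working form of [is_condexp]: real integrals against indicators replace extended integrals over
    sets. *)
Lemma is_condexpP C W Z : C `<=` measurable -> is_condexp P <<s C >> W Z <->
  [/\ P.-integrable setT (EFin \o W), P.-integrable setT (EFin \o Z),
      measurable_fun setT (Z : g_sigma_algebraType C -> R) &
      forall A, <<s C >> A -> \int[P]_w (\1_A w * Z w) = \int[P]_w (\1_A w * W w)].
Proof.
move=> /g_sigma_sub_measurable Cm; split=> -[Wi Zi mZ WZ]; split=> //.
- exact/g_sigma_measurable_funE.
- move=> A CA; apply: EFin_inj; rewrite -!integral_Rintegral//; [exact: WZ|..];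
    exact: Cm.
- exact/g_sigma_measurable_funE.
- move=> A CA; rewrite !integral_Rintegral//; [by rewrite WZ|..]; exact: Cm.
Qed.

Lemma is_condexp_sum C (I : Type) (r : seq I) (c : I -> R) (W Z : I -> T -> R) :
  C `<=` measurable -> (forall i, is_condexp P <<s C >> (W i) (Z i)) ->
  is_condexp P <<s C >> (fun w => \sum_(i <- r) c i * W i w)
    (fun w => \sum_(i <- r) c i * Z i w).
Proof.
move=> Cm WZ.
have sumi (F : I -> T -> R) : (forall i, P.-integrable setT (EFin \o F i)) ->
    P.-integrable setT (EFin \o (fun w => \sum_(i <- r) c i * F i w)).
  move=> Fi; rewrite (_ : _ \o _ =
      fun w => (\sum_(j <- r) (c j)%:E * (F j w)%:E)%E).
    by apply: integrable_sum => // j _; apply: integrableZl => //; exact: Fi.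
  by apply/funext => w /=; rewrite -sumEFin.
have Wi i : P.-integrable setT (EFin \o W i) by case: (WZ i).
have Zi i : P.-integrable setT (EFin \o Z i) by case: (WZ i).
apply/is_condexpP => //; split; [exact: sumi|exact: sumi|..].
  apply: measurable_sum => i.
  have /is_condexpP[//|_ _ mZ _] := WZ i.
  by apply: measurable_funM => //; exact: measurable_cst.
move=> A CA.
have mA := g_sigma_sub_measurable Cm _ CA.
have intE (F : I -> T -> R) : (forall i, P.-integrable setT (EFin \o F i)) ->
    \int[P]_w (\1_A w * (\sum_(i <- r) c i * F i w)) =
    \sum_(i <- r) c i * \int[P]_w (\1_A w * F i w).
  move=> Fi.
  have AFi i : P.-integrable setT (EFin \o (fun w => \1_A w * F i w)).
    apply: (@integrableM_bounded _ _ 1) => // w.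
    by rewrite indicE normr_nat; case: (_ \in _).
  transitivity (\int[P]_w (\sum_(i <- r) c i * (\1_A w * F i w))).
    apply: eq_Rintegral => w _; rewrite mulr_sumr; apply: eq_bigr => i _.
    by rewrite mulrCA.
  rewrite Rintegral_sum//; first by apply: eq_bigr => i _; rewrite RintegralZl.
  by move=> i; exact: (integrableZl _ (c i) (AFi i)).
rewrite !intE//; apply: eq_bigr => i _; congr (_ * _).
by have /is_condexpP[//|_ _ _] := WZ i; apply.
Qed.

Lemma is_condexp_cst C (c : R) : C `<=` measurable ->
  is_condexp P <<s C >> (cst c) (cst c).
Proof.
move=> Cm; have ci : P.-integrable setT (EFin \o cst c).
  exact: (@bounded_integrable _ `|c|).
by apply/is_condexpP => //; split=> //; exact: measurable_cst.
Qed.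

(** The measurable sets over which [f] integrates to 0 form a Dynkin system. Closure under
    complement uses the total integral, which is 0 because [C setT]. *)
Lemma Rintegral_pi_system C f : setI_closed C -> C `<=` measurable -> C setT ->
  P.-integrable setT (EFin \o f) ->
  (forall A, C A -> \int[P]_w (\1_A w * f w) = 0) ->
  forall A, <<s C >> A -> \int[P]_w (\1_A w * f w) = 0.
Proof.
move=> CI Cm CT fi C0.
have Em A : measurable A ->
    \int[P]_w (\1_A w * f w) = 0 <-> (\int[P]_(w in A) (f w)%:E = 0)%E.
  by move=> mA; rewrite integral_Rintegral//; split=> [->//|[]].
pose D := [set A | measurable A /\ (\int[P]_(w in A) (f w)%:E = 0)%E].
suff CD : <<s C >> `<=` D by move=> A /CD[mA]; rewrite Em.
have mf : measurable_fun setT (EFin \o f) := measurable_int _ fi.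
have T0 : (\int[P]_w (f w)%:E = 0)%E by apply/Em => //; exact: C0.
rewrite -setI_closed_g_dynkin_g_sigma_algebra//; apply: smallest_sub; last first.
  by move=> A CA; split; [exact: Cm|apply/Em; [exact: Cm|exact: C0]].
split=> [|A [mA A0]|F tF DF]; first by split.
- split; first exact: measurableC.
  move: T0; rewrite -(setvU A) setUC integral_setU//.
  + by rewrite A0 add0e.
  + exact: measurableC.
  + by rewrite setUC setvU.
  + by apply/disj_setPS => x [].
- have mF k : measurable (F k) by case: (DF k).
  split; first exact: bigcup_measurable.
  rewrite integral_bigcup//; last first.
    by apply: integrableS fi => //; exact: bigcup_measurable.
  by rewrite eseries0// => k _ _; case: (DF k).
Qed.

(* [H] is within [1/n] of [\sum_(j < n) (1/n) * 1_{H >= (j+1)/n}], so that the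
   case of indicators suffices. *)
Lemma Rintegral_mul0 {C f H} : C `<=` measurable ->
  P.-integrable setT (EFin \o f) ->
  (forall A, <<s C >> A -> \int[P]_w (\1_A w * f w) = 0) ->
  measurable_fun setT (H : g_sigma_algebraType C -> R) ->
  (forall w, 0 <= H w <= 1) ->
  \int[P]_w (H w * f w) = 0.
Proof.
move=> Cm fi f0 mH H01.
pose A n j := [set w | j.+1%:R / n.+1%:R <= H w].
have CA n j : <<s C >> (A n j).
  have /g_sigma_measurable_funE/(_ `[j.+1%:R / n.+1%:R, +oo[%classic) := mH.
  rewrite (_ : _ @^-1` _ = A n j); first by apply; exact: measurable_itv.
  by apply/funext => w; rewrite /A /= in_itv/= andbT.
pose h n w : R := \sum_(j < n.+1) n.+1%:R^-1 * \1_(A n j) w.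
have hH n w : `|H w - h n w| <= n.+1%:R^-1.
  have /andP[H0 H1] := H01 w.
  have n0 : 0 < n.+1%:R :> R by rewrite ltr0n.
  (* [m] counts the levels [(j + 1) / (n + 1)] that do not exceed [H w], so [h n w] is [H w] rounded
     down to a multiple of [1 / (n + 1)]. *)
  pose m := Num.trunc (H w * n.+1%:R).
  have mn : (m <= n.+1)%N.
    rewrite truncn_le_nat (le_lt_trans (y := n.+1%:R))//; last by rewrite ltr_nat.
    by rewrite ler_piMl// ltW.
  have -> : h n w = n.+1%:R^-1 * m%:R.
    rewrite /h -mulr_sumr; congr (_ * _).
    transitivity (\sum_(j < n.+1) (j < m)%:R : R).
      apply: eq_bigr => j _; rewrite indicE; congr (_%:R); congr nat_of_bool.
      rewrite /m truncn_gt_nat -ler_pdivrMr//.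
      by apply/idP/idP; rewrite inE.
    transitivity (\sum_(j < n.+1 | (j < m)%N) (1 : R)).
      by rewrite [RHS]big_mkcond; apply: eq_bigr => j _; case: ifP.
    by rewrite -(big_ord_widen _ (fun=> 1) mn) sumr_const card_ord.
  rewrite -[X in `|X - _|](mulfK (lt0r_neq0 n0)) [_ / _]mulrC -mulrBr normrM.
  rewrite ger0_norm ?invr_ge0// ler_piMr ?invr_ge0// ler_norml.
  have /andP[] : m%:R <= H w * n.+1%:R < m.+1%:R.
    by rewrite truncn_itv// mulr_ge0.
  by rewrite -natr1 => ? ?; apply/andP; split; lra.
have mh n : measurable_fun setT (h n).
  apply: (g_sigma_measurable_funW Cm); apply: measurable_sum => j.
  apply: measurable_funM; first exact: measurable_cst.
  exact: g_sigma_measurable_indic.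
have mH' := g_sigma_measurable_funW Cm mH.
have Ai n j : P.-integrable setT (EFin \o (fun w => \1_(A n j) w * f w)).
  apply: (@integrableM_bounded _ _ 1) => //.
    by apply: (g_sigma_measurable_funW Cm); exact: g_sigma_measurable_indic.
  by move=> w; rewrite indicE normr_nat; case: (_ \in _).
have h0 n : \int[P]_w (h n w * f w) = 0.
  transitivity (\int[P]_w (\sum_(j < n.+1) n.+1%:R^-1 * (\1_(A n j) w * f w))).
    apply: eq_Rintegral => w _; rewrite mulr_suml.
    by apply: eq_bigr => j _; rewrite mulrA.
  rewrite Rintegral_sum// => [|j]; last exact: (integrableZl _ n.+1%:R^-1 (Ai n j)).
  by apply: big1 => j _; rewrite RintegralZl// f0// mulr0.
pose c := \int[P]_w `|f w|.
have Hfi : P.-integrable setT (EFin \o (fun w => H w * f w)).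
  apply: (@integrableM_bounded _ _ 1) => // w.
  by case/andP: (H01 w) => ? ?; rewrite ger0_norm.
have hfi n : P.-integrable setT (EFin \o (fun w => h n w * f w)).
  apply: (@integrableM_bounded _ _ 2) => // w.
  have n1 : n.+1%:R^-1 <= 1 :> R by rewrite invf_le1 ?ler1n ?ltr0n.
  rewrite -[h n w](subKr (H w)); apply: le_trans (ler_normB _ _) _.
  apply: (lerD _ (le_trans (hH n w) n1)).
  by case/andP: (H01 w) => ? ?; rewrite ger0_norm.
have bnd n : `|\int[P]_w (H w * f w)| <= n.+1%:R^-1 * c.
  have -> : \int[P]_w (H w * f w) = \int[P]_w ((H w - h n w) * f w).
    rewrite -[LHS]subr0 -(h0 n) -RintegralB//.
    by apply: eq_Rintegral => w _; rewrite mulrBl.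
  have di : P.-integrable setT (EFin \o (fun w => (H w - h n w) * f w)).
    apply: (@integrableM_bounded _ _ n.+1%:R^-1) => //.
    exact: measurable_funB.
  apply: le_trans (le_normr_Rintegral _ di) _ => //.
  rewrite /c -RintegralZl//; last exact: integrable_norm.
  apply: le_Rintegral => //.
  - exact: integrable_norm.
  - apply: (@integrableZl _ _ _ _ _ _ n.+1%:R^-1
      (EFin \o (Num.norm \o f))) => //.
    exact: integrable_norm.
  - by move=> w _; rewrite normrM ler_wpM2r.
apply/eqP; rewrite -normr_le0.
have lim0 : n.+1%:R^-1 * c @[n --> \oo] --> 0 * c.
  by apply: cvgM; [exact: cvg_harmonic|exact: cvg_cst].
rewrite -(mul0r c) -(cvg_lim _ lim0)//; apply: limr_ge; first exact: cvgP lim0.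
by near=> n; exact: bnd.
Unshelve. all: by end_near.
Qed.

(** Apply [Rintegral_mul0] to [Z - W]. The factors needed later, products of indicators, coordinates
    of [X] and exponentials of nonpositive numbers, all lie between 0 and 1. *)
Lemma is_condexp_mul {C W Z H} : C `<=` measurable -> is_condexp P <<s C >> W Z ->
  measurable_fun setT (H : g_sigma_algebraType C -> R) ->
  (forall w, 0 <= H w <= 1) ->
  \int[P]_w (H w * Z w) = \int[P]_w (H w * W w).
Proof.
move=> Cm /is_condexpP[//|Wi Zi mZ WZ] mH H01.
have mH' := g_sigma_measurable_funW Cm mH.
have mul_i (K F : T -> R) : measurable_fun setT K -> (forall w, 0 <= K w <= 1) ->
    P.-integrable setT (EFin \o F) ->
    P.-integrable setT (EFin \o (fun w => K w * F w)).
  move=> mK K01 Fi; apply: (@integrableM_bounded _ _ 1) => // w.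
  by case/andP: (K01 w) => ? ?; rewrite ger0_norm.
have Di : P.-integrable setT (EFin \o (fun w => Z w - W w)).
  exact: (integrableB _ Zi Wi).
have BE (K : T -> R) : measurable_fun setT K -> (forall w, 0 <= K w <= 1) ->
    \int[P]_w (K w * (Z w - W w)) = \int[P]_w (K w * Z w) - \int[P]_w (K w * W w).
  move=> mK K01; rewrite -RintegralB//; [|exact: mul_i..].
  by apply: eq_Rintegral => w _; rewrite mulrBr.
apply/eqP; rewrite -subr_eq0 -BE//; apply/eqP.
apply: (Rintegral_mul0 Cm Di) => // A CA.
rewrite BE ?WZ ?subrr//; first exact/measurable_indic/(g_sigma_sub_measurable Cm).
by move=> w; rewrite indicE; case: (_ \in _); rewrite ?lexx ler01.
Qed.

End ConditionalExpectation.

(** * Riemann sums of right-continuous functions *)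

Section RiemannSums.
Context {R : realType}.
Variables (a b : R).
Hypothesis ab : a < b.

Let h n : R := (b - a) / n.+1%:R.
Let x n l : R := a + l%:R * h n.
(** Cells are closed on the right: they partition []a, b]] and each contains its sampling point. *)
Let step n l : set R := `]x n l, x n l.+1].

Let h_gt0 n : 0 < h n.
Proof. by rewrite /h divr_gt0// ?subr_gt0. Qed.

Let x_last n : x n n.+1 = b.
Proof. by rewrite /x /h mulrC divfK ?pnatr_eq0// subrKC. Qed.

Let x_le n l l' : (l <= l')%N -> x n l <= x n l'.
Proof. by move=> ll'; rewrite lerD2l ler_wpM2r ?ler_nat// ltW. Qed.

Let stepP n u : a < u <= b -> exists2 l, (l < n.+1)%N & step n l u.
Proof.
move=> /andP[au ub].
have ex : exists m, u <= x n m by exists n.+1; rewrite x_last.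
case: (ex_minnP ex) => -[|l] ul lmin.
  by move: ul; rewrite /x mul0r addr0 leNgt au.
exists l; first by apply: lmin; rewrite x_last.
rewrite /step /= in_itv/= ul andbT ltNge; apply/negP => /lmin.
by rewrite ltnn.
Qed.

Let step_inj n u l l' : step n l u -> step n l' u -> l = l'.
Proof.
have le m m' : step n m u -> step n m' u -> (m <= m')%N.
  rewrite /step/= !in_itv/= => /andP[mu _] /andP[_ um'].
  rewrite leqNgt; apply/negP => /(x_le n) m'm.
  by have := lt_le_trans mu (le_trans um' m'm); rewrite ltxx.
by move=> lu lu'; apply/eqP; rewrite eqn_leq !le.
Qed.

(** The Riemann sum is the integral of the step function taking on each cell the value of [f] at the
    right end. These ends approach [u] from the right, so right-continuity gives pointwise
    convergence, and bounded convergence does the rest, integrability of [f] included. *)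
Lemma cvg_Riemann_right (f : R -> R) (c : R) :
  (forall u, a <= u -> `|f u| <= c) ->
  (forall u, a <= u -> f v @[v --> u^'+] --> f u) ->
  lebesgue_measure.-integrable `]a, b]%classic (EFin \o f) /\
  (b - a) / n.+1%:R *
    \sum_(l < n.+1) f (a + l.+1%:R * ((b - a) / n.+1%:R)) @[n --> \oo] -->
  \int[lebesgue_measure]_(u in `]a, b]) f u.
Proof.
move=> fc fr.
pose g n u : R := \sum_(l < n.+1) f (x n l.+1) * \1_(step n l) u.
have gE n u l : (l < n.+1)%N -> step n l u -> g n u = f (x n l.+1).
  move=> ln ul; rewrite /g (bigD1 (Ordinal ln))//= indicE mem_set// mulr1.
  rewrite big1 ?addr0// => l' /eqP ll'; rewrite indicE memNset ?mulr0//.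
  by move=> /(step_inj _ _ _ _ ul) e; apply: ll'; apply: val_inj.
have x_ge n l : a <= x n l by rewrite lerDl mulr_ge0// ltW.
have stepS n l : (l < n.+1)%N -> step n l `<=` `]a, b]%classic.
  move=> ln u; rewrite /step/= !in_itv/= => /andP[lu ul].
  by rewrite (le_lt_trans (x_ge n l))//= -(x_last n) (le_trans ul)// x_le.
have lab : (lebesgue_measure (`]a, b]%classic : set R) < +oo)%E.
  by rewrite lebesgue_measure_itv/= lte_fin ab ltry.
have step_leb n l : (@lebesgue_measure R (step n l) = (h n)%:E)%E.
  have xS : x n l.+1 = x n l + h n by rewrite /x -natr1 mulrDl mul1r addrA.
  transitivity (@lebesgue_measure R [set` `]x n l, x n l.+1]]) => //.
  by rewrite lebesgue_measure_itv/= lte_fin xS ltrDl h_gt0 -EFinB addrAC subrr add0r.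
have := @Rintegral_bounded_cvg _ _ _ (@lebesgue_measure R) `]a, b]%classic g f c.
case.
- exact: measurable_itv.
- exact: lab.
- move=> n; apply: measurable_sum => l; apply: measurable_funM => //.
  apply: measurable_indic; exact: measurable_itv.
- move=> n u; rewrite /= in_itv/= => /(stepP n _)[l ln ul].
  by rewrite (gE _ _ _ ln ul) fc.
- move=> u; rewrite /= in_itv/= => uab.
  apply/cvgrPdist_lt => e e0.
  have /cvgrPdist_lt/(_ _ e0)[r /= r0 fur] := fr u (ltW (andP uab).1).
  have hr : h n @[n --> \oo] --> 0.
    rewrite -(mulr0 (b - a)); apply: cvgM; first exact: cvg_cst.
    exact: cvg_harmonic.
  near=> n.
  have [l ln ul] := stepP n _ uab.
  rewrite (gE _ _ _ ln ul).
  move: ul; rewrite /step/= in_itv/= => /andP[lu].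
  (* The sampling point is [u] itself or lies to its right within [h n]; right-continuity is needed
     in the second case. *)
  rewrite le_eqVlt => /predU1P[<-|ul]; first by rewrite subrr normr0.
  apply: fur => //=; rewrite ltr_distlC -/(h n).
  have xS : x n l.+1 = x n l + h n by rewrite /x -natr1 mulrDl mul1r addrA.
  have : h n < r.
    rewrite -[h n]gtr0_norm// -normrN -sub0r.
    by near: n; move/cvgrPdist_lt : hr; apply.
  by rewrite xS in ul *; move=> ?; apply/andP; split; lra.
- move=> fi cv; split=> //.
  have indic_i n l : lebesgue_measure.-integrable `]a, b]%classic
      (EFin \o (\1_(step n l) : R -> R)).
    apply: measurable_bounded_integrable => //.
      by apply: measurable_indic; exact: measurable_itv.
    exists 1; split; first exact: num_real.
    move=> M M1 u _ /=; rewrite indicE normr_nat (le_trans _ (ltW M1))// lern1.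
    exact: leq_b1.
  apply: cvg_trans cv; apply: near_eq_cvg; apply: nearW => n.
  rewrite Rintegral_sum//.
    rewrite mulr_sumr; apply: eq_bigr => l _.
    rewrite RintegralZl//.
    rewrite mulrC; congr (_ * _).
    rewrite /Rintegral integral_indic//; last exact: measurable_itv.
    rewrite (setIidl (stepS n l (ltn_ord l))).
    by transitivity (fine (h n)%:E) => //; congr fine; exact: step_leb.
  move=> l.
  have := @integrableZl _ _ _ _ _ _ (f (x n l.+1)) _ (indic_i n l).
  by apply; exact: measurable_itv.
Unshelve. all: by end_near.
Qed.

End RiemannSums.

(** * The Feynman-Kac formula *)

Section ProcessSigmaAlgebra.
Context {R : realType} {disp : measure_display} {T : measurableType disp}
        {I : Type}.
Implicit Types (Z : I -> R -> T -> R) (D : set R).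

(* [sigma_process Z D] is convertible to [<<s process_generators Z D>>]; the
   generators are named because [g_sigma_algebraType] is indexed by them. *)
Definition process_generators Z D : set_system T :=
  \bigcup_(p in [set p : I * R | D p.2])
    preimage_set_system setT (Z p.1 p.2) measurable.

Lemma process_generators_measurable Z D :
  (forall i u, D u -> measurable_fun setT (Z i u)) ->
  process_generators Z D `<=` measurable.
Proof. by move=> mZ A [[i u] /= Du] [B mB <-]; exact: mZ. Qed.

Lemma process_generators_sub Z D D' : D `<=` D' ->
  process_generators Z D `<=` <<s process_generators Z D' >>.
Proof.
move=> DD' A [[i u] /= Du ZA]; apply: sub_sigma_algebra.
by exists (i, u) => //=; exact: DD'.
Qed.

Lemma process_measurable Z D i u : D u ->
  measurable_fun setT (Z i u : g_sigma_algebraType (process_generators Z D) -> R).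
Proof.
move=> Du _ B mB; apply: sub_sigma_algebra; exists (i, u) => //=.
by exists B.
Qed.

End ProcessSigmaAlgebra.

(** The inequality [1 + y <= expR y] at [y = - k x] and at [y = k x] squeezes the slope between
    [- k] and [- k / (1 + k x)]. *)
Lemma cvg_expR_slope (R : realType) (k : R) : 0 <= k ->
  x^-1 * (expR (- (k * x)) - 1) @[x --> 0^'+] --> - k.
Proof.
move=> k0.
have idr : x @[x --> (0 : R)^'+] --> (0 : R) by exact: cvg_at_right_filter.
apply: (squeeze_cvgr (f := cst (- k)) (h := fun x => - (k / (1 + k * x)))).
- near=> x.
  have x0 : 0 < x by near: x; exact: nbhs_right_gt.
  have kx0 : 0 < 1 + k * x by rewrite ltr_pwDl// mulr_ge0// ltW.
  rewrite -(ler_pM2l x0) -[X in _ && X](ler_pM2l x0) mulVKf ?lt0r_neq0//.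
  apply/andP; split.
    by rewrite lerBrDr /cst mulrN [x * k]mulrC addrC expR_ge1Dx.
  rewrite lerBlDr expRN (_ : _ + 1 = (1 + k * x)^-1); last first.
    by field; rewrite lt0r_neq0.
  by rewrite lef_pV2 ?posrE ?expR_gt0// expR_ge1Dx.
- exact: cvg_cst.
- have : - (k / (1 + k * x)) @[x --> 0^'+] --> - (k / (1 + k * 0)).
    apply: cvgN; apply: cvgM; first exact: cvg_cst.
    apply: cvgV; first by rewrite mulr0 addr0 oner_neq0.
    apply: cvgD; first exact: cvg_cst.
    by apply: cvgM; [exact: cvg_cst|exact: idr].
  by rewrite mulr0 addr0 divr1.
Unshelve. all: by end_near.
Qed.

(** * The modulating chain and its cumulated intensity *)

Section MarkovChain.
Context {R : realType} {disp : measure_display} {T : measurableType disp}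
        {d : nat}.
Context {P : probability T R} {Q : 'M[R]_d} {lam : 'cV[R]_d}
        {X : R -> T -> 'cV[R]_d}.
Context (hlam : forall i, 0 <= lam i 0) (hX : markov_chain P Q X).

Notation gensX D := (process_generators (fun (i : 'I_d) t w => X t w i 0) D).

Definition rate u w : R := (lam^T *m X u w) 0 0.

Lemma rateE u w : rate u w = \sum_a lam a 0 * X u w a 0.
Proof. by rewrite /rate mxE; apply: eq_bigr => a _; rewrite mxE. Qed.

Lemma X_measurable u i : 0 <= u -> measurable_fun setT (fun w => X u w i 0).
Proof. by move=> u0; case: hX => + _ _ _; apply. Qed.

Lemma gensX_measurable (D : set R) : D `<=` [set u | 0 <= u] ->
  gensX D `<=` measurable.
Proof.
move=> D0; apply: process_generators_measurable => i u /D0; exact: X_measurable.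
Qed.

Lemma gensX_itv_measurable s : gensX `[0, s]%classic `<=` measurable.
Proof. by apply: gensX_measurable => u /=; rewrite in_itv/= => /andP[]. Qed.

Lemma X_basis {u} w : 0 <= u -> exists b, forall a, X u w a 0 = (a == b)%:R.
Proof.
move=> u0; case: hX => _ /(_ u w u0)[b Xb] _ _; exists b => a.
by rewrite Xb mxE eqxx andbT.
Qed.

Lemma X_itv {u} w a : 0 <= u -> 0 <= X u w a 0 <= 1.
Proof.
by move=> /(X_basis w)[b ->]; case: (a == b); rewrite ?lexx ler01.
Qed.

Lemma rate_ge0 {u} w : 0 <= u -> 0 <= rate u w.
Proof.
move=> u0; rewrite rateE sumr_ge0// => a _; apply: mulr_ge0 => //.
by case/andP: (X_itv w a u0).
Qed.

Lemma rate_le u w : 0 <= u -> rate u w <= \sum_a lam a 0.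
Proof.
move=> u0; rewrite rateE; apply: ler_sum => a _.
by rewrite ler_piMr//; case/andP: (X_itv w a u0).
Qed.

(* [X u w] is the basis vector [e_b], for which both sides vanish unless
   [a = b], and then [rate u w = lam_b]. *)
Lemma fun_rate_mulX (g : R -> R) u w a : 0 <= u ->
  g (rate u w) * X u w a 0 = g (lam a 0) * X u w a 0.
Proof.
move=> u0; have [b Xb] := X_basis w u0.
rewrite rateE (bigD1 b)//= Xb eqxx mulr1 big1 ?addr0 => [|c /negbTE cb].
  by rewrite Xb; case: eqP => [->//|_]; rewrite !mulr0.
by rewrite Xb cb mulr0.
Qed.

Lemma rate_right_cont u w : 0 <= u ->
  rate v w @[v --> u^'+] --> rate u w.
Proof.
move=> u0; case: hX => _ _ /(_ w)[/(_ u u0) cX _] _.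
rewrite rateE; under eq_fun do rewrite rateE.
apply: cvg_sumr => a; apply: cvgM; first exact: cvg_cst.
exact: (cvg_comp _ _ cX (@coord_continuous _ _ _ a 0 (X u w))).
Qed.

Lemma rate_measurable (D : set R) u : D u ->
  measurable_fun setT (rate u : g_sigma_algebraType (gensX D) -> R).
Proof.
move=> Du; rewrite (_ : rate u = fun w => \sum_a lam a 0 * X u w a 0).
  apply: measurable_sum => a; apply: measurable_funM; first exact: measurable_cst.
  exact: (process_measurable (fun (i : 'I_d) t w => X t w i 0)).
by apply/funext => w; exact: rateE.
Qed.

Lemma cum_intensity0 {u} w : u <= 0 -> cum_intensity lam X u w = 0.
Proof.
rewrite /cum_intensity le_eqVlt => /predU1P[->|u0].
  by rewrite set_itv1 Rintegral_set1.
by rewrite set_itv_ge ?Rintegral_set0// bnd_simp -ltNge.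
Qed.

(** Integrability is one of the conclusions of [cvg_Riemann_right]; the bound is the sum of the
    [lam a], as the coordinates of [X] lie between 0 and 1. *)
Lemma rate_integrable t w : 
  lebesgue_measure.-integrable `]0, t]%classic (EFin \o rate^~ w).
Proof.
have [t0|t0] := ltP 0 t; last first.
  rewrite set_itv_ge; last by rewrite bnd_simp -leNgt.
  exact: integrable_set0.
apply: (cvg_Riemann_right 0 t t0 _ (\sum_a lam a 0) _ _).1 => u u0.
  by rewrite ger0_norm ?rate_ge0// rate_le.
exact: rate_right_cont.
Qed.

(** Dropping the endpoint 0 turns increments of the cumulated intensity into integrals over []s,
    t]], the intervals of the Riemann sums. *)
Lemma cum_intensityE t w :
  cum_intensity lam X t w = \int[lebesgue_measure]_(u in `]0, t]) rate u w.
Proof.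
have [t0|t0] := ltP 0 t.
  by rewrite /cum_intensity -Rintegral_itv_obnd_cbnd//; exact: rate_integrable.
rewrite cum_intensity0// set_itv_ge ?Rintegral_set0//.
by rewrite bnd_simp -leNgt.
Qed.

Lemma cum_intensity_Riemann {s t} w : 0 <= s -> s < t ->
  (t - s) / n.+1%:R * \sum_(l < n.+1) rate (s + l.+1%:R * ((t - s) / n.+1%:R)) w
    @[n --> \oo] --> cum_intensity lam X t w - cum_intensity lam X s w.
Proof.
move=> s0 st.
rewrite !cum_intensityE Rintegral_itvB ?bnd_simp//; last 2 first.
- exact: rate_integrable.
- exact: ltW.
apply: (cvg_Riemann_right s t st (rate^~ w) (\sum_a lam a 0) _ _).2 => u su.
  have u0 := le_trans s0 su.
  by rewrite ger0_norm ?rate_ge0// rate_le.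
by apply: rate_right_cont; exact: le_trans su.
Qed.

Lemma cum_intensity_le {s t} w : 0 <= s -> s <= t ->
  cum_intensity lam X s w <= cum_intensity lam X t w.
Proof.
move=> s0; rewrite le_eqVlt => /predU1P[->//|st].
have cv := cum_intensity_Riemann w s0 st.
rewrite -subr_ge0 -(cvg_lim _ cv)//; apply: limr_ge; first exact: cvgP cv.
have ts : 0 <= t - s by rewrite subr_ge0 ltW.
apply: nearW => n; rewrite mulr_ge0 ?divr_ge0// sumr_ge0// => l _.
by rewrite rate_ge0// addr_ge0// mulr_ge0// divr_ge0.
Qed.

Lemma cum_intensity_ge0 t w : 0 <= cum_intensity lam X t w.
Proof.
have [t0|t0] := leP 0 t; last by rewrite cum_intensity0// ltW.
by rewrite -(cum_intensity0 w (lexx 0)) cum_intensity_le.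
Qed.

(** A pointwise limit of Riemann sums whose sampling times all lie in [[0, t]]. *)
Lemma cum_intensity_measurable (D : set R) t : `[0, t]%classic `<=` D ->
  measurable_fun setT (cum_intensity lam X t : g_sigma_algebraType (gensX D) -> R).
Proof.
move=> tD; have [t0|t0] := ltP 0 t; last first.
  rewrite (_ : cum_intensity _ _ _ = cst 0); first exact: measurable_cst.
  by apply/funext => w; rewrite cum_intensity0.
apply: (@measurable_fun_cvg _ (g_sigma_algebraType (gensX D)) R setT
  (fun n w => (t - 0) / n.+1%:R *
  \sum_(l < n.+1) rate (0 + l.+1%:R * ((t - 0) / n.+1%:R)) w)).
  move=> n; apply: measurable_funM; first exact: measurable_cst.
  apply: measurable_sum => l; apply: rate_measurable; apply: tD.
  rewrite /= in_itv/= add0r subr0 mulr_ge0 ?divr_ge0 ?(ltW t0)//=.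
  by rewrite mulrCA ler_piMr ?(ltW t0)// ler_pdivrMr// mul1r ler_nat.
move=> w _; have := cum_intensity_Riemann w (lexx 0) t0.
by rewrite (cum_intensity0 w (lexx 0)) => ?; rewrite -[X in _ --> X]subr0.
Qed.

(** The vector [E[K X_u]]. Conditional expectations given the past up to [s] are handled through it,
    with [K] a test function measurable at time [s]. *)
Definition meanX u (K : T -> R) : 'cV[R]_d := \col_a \int[P]_w (K w * X u w a 0).

Lemma bounded_mulX_integrable {u} {K : T -> R} a : 0 <= u ->
  measurable_fun setT K -> (forall w, 0 <= K w <= 1) ->
  P.-integrable setT (EFin \o (fun w => K w * X u w a 0)).
Proof.
move=> u0 mK K01.
apply: (@bounded_integrable _ _ _ _ _ 1).
  by apply: measurable_funM => //; exact: X_measurable.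
move=> w; rewrite normrM; have /andP[? ?] := K01 w.
by have /andP[? ?] := X_itv w a u0; rewrite !ger0_norm ?mulr_ile1.
Qed.

Section FeynmanKac.
Variables (Pt : R -> 'M[R]_d) (m : nat).
Hypothesis PtQ : has_intensities Pt Q.
Hypothesis PtX : forall s t, 0 <= s <= t ->
  is_condexp_cV P (FX X `[0, s]) (X t) (fun w => Pt (t - s) *m X s w).

(** By [fun_rate_mulX], multiplying [X u] by [expR (- (m h rate))] at the same time [u] amounts to
    applying this diagonal matrix. *)
Let damp h : 'M[R]_d := diag_mx (\row_a expR (- (m%:R * h * lam a 0))).

Lemma meanX_markov {s t : R} {K : T -> R} : 0 <= s -> s <= t ->
  measurable_fun setT (K : g_sigma_algebraType (gensX `[0, s]%classic) -> R) ->
  (forall w, 0 <= K w <= 1) -> meanX t K = Pt (t - s) *m meanX s K.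
Proof.
move=> s0 st mK K01; apply/matrixP => a b; rewrite ord1 !mxE.
have /PtX/(_ a) ce : 0 <= s <= t by rewrite s0.
rewrite -(is_condexp_mul (gensX_itv_measurable s) ce mK K01).
have mK' := g_sigma_measurable_funW (gensX_itv_measurable s) mK.
transitivity (\int[P]_w (\sum_c Pt (t - s) a c * (K w * X s w c 0))).
  apply: eq_Rintegral => w _; rewrite mxE mulr_sumr.
  by apply: eq_bigr => c _; rewrite mulrCA.
have Ki c := bounded_mulX_integrable c s0 mK' K01.
rewrite Rintegral_sum//.
  by apply: eq_bigr => c _; rewrite mxE RintegralZl.
by move=> c; exact: (integrableZl _ (Pt (t - s) a c) (Ki c)).
Qed.

(** Induction on the number of steps. The factor at the last sampling time acts as [damp h] on [X]
    at that same time, which is why right ends are sampled; the other factors are known one step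
    earlier, so [meanX_markov] contributes [Pt h]. *)
Lemma meanX_discrete {s h : R} N {K : T -> R} : 0 <= s -> 0 <= h ->
  measurable_fun setT (K : g_sigma_algebraType (gensX `[0, s]%classic) -> R) ->
  (forall w, 0 <= K w <= 1) ->
  meanX (s + N%:R * h) (fun w => K w *
    expR (- (m%:R * (h * \sum_(l < N) rate (s + l.+1%:R * h) w)))) =
  (damp h *m Pt h) ^+ N *m meanX s K.
Proof.
move=> s0 h0 mK K01; elim: N => [|N IH].
  rewrite mul0r addr0 expr0 mul1mx; congr meanX; apply/funext => w.
  by rewrite big_ord0 !mulr0 oppr0 expR0 mulr1.
set KN := (fun w : T => _) in IH.
have u_ge0 l : 0 <= s + l%:R * h by rewrite addr_ge0// mulr_ge0.
have KN01 w : 0 <= KN w <= 1.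
  have /andP[K0 K1] := K01 w; rewrite mulr_ge0 ?expR_ge0// mulr_ile1 ?expR_ge0//.
  by rewrite expR_le1 oppr_le0 mulr_ge0// mulr_ge0// sumr_ge0// => l _; exact: rate_ge0.
have mKN : measurable_fun setT
    (KN : g_sigma_algebraType (gensX `[0, s + N%:R * h]%classic) -> R).
  apply: measurable_funM.
    apply: g_sigma_measurable_fun_sub mK; apply: process_generators_sub => u /=.
    rewrite !in_itv/= => /andP[-> us]; apply: (le_trans us).
    by rewrite lerDl mulr_ge0.
  apply: measurableT_comp => //; apply: measurable_funN.
  apply: measurable_funM; first exact: measurable_cst.
  apply: measurable_funM; first exact: measurable_cst.
  apply: measurable_sum => l; apply: rate_measurable.
  by rewrite /= in_itv/= u_ge0/= lerD2l ler_wpM2r// ler_nat.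
have uS : s + N.+1%:R * h = s + N%:R * h + h by rewrite -natr1 mulrDl mul1r addrA.
have stepN : meanX (s + N.+1%:R * h) KN = Pt h *m meanX (s + N%:R * h) KN.
  rewrite (meanX_markov (u_ge0 N) _ mKN KN01); last by rewrite uS lerDl.
  by rewrite uS addrAC subrr add0r.
rewrite exprS -[_ * _ ^+ N]/(_ *m _) -[RHS]mulmxA -IH -mulmxA -stepN.
apply/matrixP => a b; rewrite ord1 mul_diag_mx !mxE.
rewrite -RintegralZl//; last first.
  apply: bounded_mulX_integrable => //.
  exact: g_sigma_measurable_funW (gensX_itv_measurable _) mKN.
apply: eq_Rintegral => w _.
rewrite big_ord_recr/= mulrDr mulrDr opprD expRD mulrA -/(KN w) -mulrA.
rewrite (fun_rate_mulX (fun r => expR (- (m%:R * (h * r)))))// mulrCA.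
by rewrite [m%:R * (h * _)]mulrA.
Qed.

(** Write [D P - 1 = D (P - 1) + (D - 1)] for [D] and [P] at [h], and [n + 1 = (t - s) / h]. Then
    [D] tends to 1, [(P - 1) / h] to [Q], and [(D - 1) / h] to [- m diag(lam)]. *)
Lemma cvg_damped_generator {s t : R} : s < t -> forall a b,
  n.+1%:R * (damp ((t - s) / n.+1%:R) *m Pt ((t - s) / n.+1%:R) - 1) a b
    @[n --> \oo] --> ((t - s) *: Qlam Q lam m) a b.
Proof.
move=> st a b.
pose h n : R := (t - s) / n.+1%:R.
have ts : 0 < t - s by rewrite subr_gt0.
have h_gt0 n : 0 < h n by rewrite divr_gt0.
have h_cvg : h n @[n --> \oo] --> (0 : R).
  rewrite -(mulr0 (t - s)); apply: cvgM; first exact: cvg_cst.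
  exact: cvg_harmonic.
have along (f : R -> R) (l : R) : f x @[x --> 0^'+] --> l ->
    f (h n) @[n --> \oo] --> l by move=> /cvg_at_rightP; apply.
have PtQab : (h n)^-1 * (Pt (h n) a b - (a == b)%:R) @[n --> \oo] --> Q a b.
  apply: (along (fun x => x^-1 * (Pt x a b - (a == b)%:R))).
  apply: cvg_trans (cvg_comp _ _ PtQ (@coord_continuous _ _ _ a b Q)).
  by apply: near_eq_cvg; apply: nearW => x; rewrite /= !mxE.
have slope : (h n)^-1 * (expR (- (m%:R * lam a 0 * h n)) - 1) @[n --> \oo] -->
    - (m%:R * lam a 0).
  apply: (along (fun x => x^-1 * (expR (- (m%:R * lam a 0 * x)) - 1))).
  by apply: cvg_expR_slope; rewrite mulr_ge0.
have damp1 : expR (- (m%:R * lam a 0 * h n)) @[n --> \oo] --> (1 : R).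
  have : expR (- (m%:R * lam a 0 * h n)) @[n --> \oo] -->
      expR (- (m%:R * lam a 0 * 0)).
    apply: continuous_cvg; first exact: continuous_expR.
    by apply: cvgN; apply: cvgM; [exact: cvg_cst|exact: h_cvg].
  by rewrite mulr0 oppr0 expR0.
have -> : ((t - s) *: Qlam Q lam m) a b =
    (t - s) * (1 * Q a b + (a == b)%:R * - (m%:R * lam a 0)).
  by rewrite /Qlam !mxE; case: eqP => _; rewrite ?mulr1n ?mulr0n/=; ring.
have cv : (t - s) * (expR (- (m%:R * lam a 0 * h n)) *
      ((h n)^-1 * (Pt (h n) a b - (a == b)%:R)) +
    (a == b)%:R * ((h n)^-1 * (expR (- (m%:R * lam a 0 * h n)) - 1))) @[n --> \oo]
    --> (t - s) * (1 * Q a b + (a == b)%:R * - (m%:R * lam a 0)).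
  apply: cvgM; first exact: cvg_cst.
  by apply: cvgD; [exact: cvgM damp1 PtQab|apply: cvgM slope; exact: cvg_cst].
apply: cvg_trans cv.
apply: near_eq_cvg; apply: nearW => n; rewrite mul_diag_mx !mxE -/(h n).
have -> : m%:R * h n * lam a 0 = m%:R * lam a 0 * h n by ring.
have -> : n.+1%:R = (t - s) * (h n)^-1.
  by rewrite /h invf_div mulrCA divff ?mulr1// lt0r_neq0.
by move: (expR _) (Pt _ _ _) (h n)^-1 => e p y; ring.
Qed.

(** Both sides are limits of [meanX_discrete] with [n + 1] steps: the left one by bounded
    convergence of the Riemann sums in the exponent, the right one by [expmx_lim_pow]. *)
Lemma feynman_kac_semigroup {s t : R} {K : T -> R} : 0 <= s -> s <= t ->
  measurable_fun setT (K : g_sigma_algebraType (gensX `[0, s]%classic) -> R) ->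
  (forall w, 0 <= K w <= 1) ->
  meanX t (fun w => K w * expR (- (m%:R *
    (cum_intensity lam X t w - cum_intensity lam X s w)))) =
  expmx ((t - s) *: Qlam Q lam m) *m meanX s K.
Proof.
(* At [s = t] the mesh degenerates, and both exponentials are trivial. *)
move=> s0; rewrite le_eqVlt => /predU1P[<-|st] mK K01.
  rewrite subrr scale0r expmx0 mul1mx; congr meanX; apply/funext => w.
  by rewrite subrr mulr0 oppr0 expR0 mulr1.
have ts : 0 < t - s by rewrite subr_gt0.
have t0 : 0 <= t by rewrite (le_trans s0) ?ltW.
pose h n : R := (t - s) / n.+1%:R.
have h0 n : 0 <= h n by rewrite divr_ge0 ?ltW.
have mK' := g_sigma_measurable_funW (gensX_itv_measurable s) mK.
pose S n w := h n * \sum_(l < n.+1) rate (s + l.+1%:R * h n) w.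
have S0 n w : 0 <= S n w.
  by rewrite mulr_ge0// sumr_ge0// => l _; rewrite rate_ge0// addr_ge0// mulr_ge0.
pose E n := damp (h n) *m Pt (h n) - 1.
apply/matrixP => a b; rewrite ord1 [LHS]mxE [RHS]mxE.
have lhs : meanX t (fun w => K w * expR (- (m%:R * S n w))) a 0 @[n --> \oo] -->
    \int[P]_w (K w * expR (- (m%:R *
      (cum_intensity lam X t w - cum_intensity lam X s w))) * X t w a 0).
  under eq_fun do rewrite mxE.
  apply: (@Rintegral_bounded_cvg _ _ _ P setT _ _ 1 _ _ _ _ _).2 => //.
  - exact: fin_num_fun_lty.
  - move=> n; apply: measurable_funM; last exact: X_measurable.
    apply: measurable_funM => //; apply: measurableT_comp => //.
    apply: measurable_funN; apply: measurable_funM; first exact: measurable_cst.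
    apply: measurable_funM; first exact: measurable_cst.
    apply: measurable_sum => l.
    apply: (g_sigma_measurable_funW (gensX_itv_measurable (s + l.+1%:R * h n))).
    by apply: rate_measurable; rewrite /= in_itv/= lexx addr_ge0// mulr_ge0.
  - move=> n w _; have /andP[? ?] := K01 w; have /andP[? ?] := X_itv w a t0.
    rewrite ger0_norm; last by rewrite !mulr_ge0// expR_ge0.
    rewrite !mulr_ile1 ?mulr_ge0 ?expR_ge0//.
    by rewrite expR_le1 oppr_le0 mulr_ge0.
  - move=> w _; apply: cvgM; last exact: cvg_cst.
    apply: cvgM; first exact: cvg_cst.
    apply: continuous_cvg; first exact: continuous_expR.
    apply: cvgN; apply: cvgM; first exact: cvg_cst.
    exact: cum_intensity_Riemann.
have rhs : ((1 + E n) ^+ n.+1 *m meanX s K) a 0 @[n --> \oo] -->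
    \sum_c expmx ((t - s) *: Qlam Q lam m) a c * meanX s K c 0.
  under eq_fun do rewrite mxE.
  apply: cvg_sumr => c; apply: cvgM; last exact: cvg_cst.
  by apply: expmx_lim_pow => i j; exact: cvg_damped_generator.
apply: cvg_unique lhs _ => //; apply: cvg_trans rhs.
apply: near_eq_cvg; apply: nearW => n.
have tE : t = s + n.+1%:R * h n by rewrite mulrC divfK// subrKC.
by rewrite [in RHS]tE (meanX_discrete n.+1 s0 (h0 n) mK K01) subrKC.
Qed.

End FeynmanKac.

Lemma feynman_kac m {s t : R} {K : T -> R} : 0 <= s -> s <= t ->
  measurable_fun setT (K : g_sigma_algebraType (gensX `[0, s]%classic) -> R) ->
  (forall w, 0 <= K w <= 1) ->
  meanX t (fun w => K w * expR (- (m%:R *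
    (cum_intensity lam X t w - cum_intensity lam X s w)))) =
  expmx ((t - s) *: Qlam Q lam m) *m meanX s K.
Proof.
by case: hX => _ _ _ [Pt [_ PtQ PtX]]; exact: feynman_kac_semigroup PtQ PtX _ _ _.
Qed.

End MarkovChain.

(** * Joint survival of a set of obligors *)

Lemma prod_expR_thresholds {R : realType} {n : nat} (D : {set 'I_n})
    (u : 'I_n -> R) (r : R) (f : R -> R) :
  \prod_i expR (- f (if i \in D then r else u i)) =
  (\prod_(i | i \notin D) expR (- f (u i))) * expR (- (#|D|%:R * f r)).
Proof.
rewrite (bigID (mem D))/= [LHS]mulrC; congr (_ * _).
  by apply: eq_bigr => i /negbTE ->.
rewrite (eq_bigr (fun=> expR (- f r))); last by move=> i ->.
by rewrite prodr_const -expRM_natl mulrN.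
Qed.

Section DefaultTimes.
Context {R : realType} {disp : measure_display} {T : measurableType disp}
        {d n : nat}.
Context {P : probability T R} {Q : 'M[R]_d} {lam : 'cV[R]_d}
        {X : R -> T -> 'cV[R]_d} {tau : 'I_n -> T -> \bar R}.
Context (hlam : forall i, 0 <= lam i 0) (hX : markov_chain P Q X)
        (htau : default_times P lam X tau).

Notation gensX D := (process_generators (fun (i : 'I_d) t w => X t w i 0) D).

Notation gensF s := (process_generators (fun z : 'I_d + 'I_n => match z with
    | inl i => fun t w => X t w i 0
    | inr i => fun t w => (Y tau i t w)%:R
    end) `[0, s]%classic).

Definition survival (D : {set 'I_n}) t w : R :=
  \prod_(i in D) (t%:E < tau i w)%E%:R.

Lemma tau_gt_measurable i u : measurable [set w | (u%:E < tau i w)%E].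
Proof.
have mtau : measurable_fun setT (tau i) by case: htau => + _ _ _; apply.
have := mtau measurableT `]u%:E, +oo[%classic (emeasurable_itv _).
rewrite setTI (_ : _ @^-1` _ = [set w | (u%:E < tau i w)%E])//.
by apply/funext => w; rewrite /= in_itv/= andbT.
Qed.

Lemma Y_tau i t w : (Y tau i t w)%:R = 1 - (t%:E < tau i w)%E%:R :> R.
Proof. by rewrite /Y leNgt; case: (_ < _)%E; rewrite ?subrr ?subr0. Qed.

Lemma gensF_measurable s : gensF s `<=` measurable.
Proof.
apply: process_generators_measurable => -[i|i] u /=; rewrite in_itv/=.
  by case/andP => u0 _; exact: (X_measurable hX).
move=> _; rewrite (_ : (fun w => _) = fun w => 1 - \1_[set w | (u%:E < tau i w)%E] w).
  apply: measurable_funB; first exact: measurable_cst.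
  by apply: measurable_indic; exact: tau_gt_measurable.
by apply/funext => w; rewrite Y_tau indicE mem_setE.
Qed.

Lemma survival_measurable s (D : {set 'I_n}) : 0 <= s ->
  measurable_fun setT (survival D s : g_sigma_algebraType (gensF s) -> R).
Proof.
move=> s0.
rewrite (_ : survival D s = fun w => \prod_(i <- enum D) (1 - (Y tau i s w)%:R)).
  apply: measurable_prod => i _; apply: measurable_funB; first exact: measurable_cst.
  apply: (process_measurable (fun z : 'I_d + 'I_n => match z with
    | inl i => fun t w => X t w i 0
    | inr i => fun t w => (Y tau i t w)%:R
    end) _ (inr i)).
  by rewrite /= in_itv/= s0 lexx.
apply/funext => w; rewrite /survival big_enum; apply: eq_bigr => i _.
by rewrite Y_tau subKr.
Qed.

Lemma survival_measurableT s (D : {set 'I_n}) : 0 <= s ->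
  measurable_fun setT (survival D s).
Proof.
move=> s0.
exact: (g_sigma_measurable_funW (gensF_measurable s) (survival_measurable s D s0)).
Qed.

Lemma survival_itv D t w : 0 <= survival D t w <= 1.
Proof.
rewrite /survival; apply/andP; split; first by apply: prodr_ge0 => i _.
by apply: prodr_ile1 => i _; case: (_ < _)%E; rewrite lexx ler01.
Qed.

(** For [u < 0] the event is certain and the cumulated intensity is 0, so the survival formula
    extends to all real thresholds. *)
Lemma tau_gt_condexp i u : is_condexp P (FX X `[0, +oo[%classic)
  \1_[set w | (u%:E < tau i w)%E] (fun w => expR (- cum_intensity lam X u w)).
Proof.
case: htau => _ tau0 + _; move=> /(_ i u); have [u0|u0 _] := leP 0 u; first exact.
rewrite (_ : \1__ = cst 1); last first.
  apply/funext => w; rewrite indicE mem_set//=.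
  by apply: lt_le_trans (tau0 i w); rewrite lte_fin.
rewrite (_ : (fun w => _) = cst 1); last first.
  by apply/funext => w; rewrite cum_intensity0 ?ltW// oppr0 expR0.
apply: is_condexp_cst; apply: (gensX_measurable hX) => u' /=.
by rewrite in_itv/= andbT.
Qed.

Lemma joint_survival_condexp (u : 'I_n -> R) :
  is_condexp P (FX X `[0, +oo[%classic)
    \1_(\bigcap_i [set w | ((u i)%:E < tau i w)%E])
    (fun w => \prod_i expR (- cum_intensity lam X (u i) w)).
Proof.
have mB i : measurable [set y : \bar R | ((u i)%:E < y)%E].
  rewrite (_ : mkset _ = `](u i)%:E, +oo[%classic); first exact: emeasurable_itv.
  by apply/funext => y; rewrite /= in_itv/= andbT.
case: htau => _ _ _ /(_ _ (fun i w => expR (- cum_intensity lam X (u i) w)) mB).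
by apply=> i; exact: tau_gt_condexp.
Qed.

(* The default times being nonnegative, [u i < 0] puts no constraint on [tau i];
   this is how the whole space belongs to the family. *)
Definition survival_rect s : set_system T :=
  [set A | exists B (u : 'I_n -> R), [/\ <<s gensX `[0, s]%classic >> B,
    forall i, u i <= s & A = B `&` \bigcap_i [set w | ((u i)%:E < tau i w)%E]]].

(** Intersecting two rectangles replaces the thresholds by their maxima. *)
Lemma survival_rect_setI s : setI_closed (survival_rect s).
Proof.
move=> _ _ [B [u [mB us ->]]] [B' [u' [mB' us' ->]]].
exists (B `&` B'), (fun i => Num.max (u i) (u' i)); split.
- exact: (@measurableI _ (g_sigma_algebraType (gensX `[0, s]%classic))).
- by move=> i; rewrite ge_max us us'.
- rewrite setIACA; congr (_ `&` _); apply/seteqP; split => w.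
    move=> [U U'] i _ /=; rewrite EFin_max gt_max.
    by apply/andP; split; [exact: U|exact: U'].
  by move=> U; split=> i _; have := U i I; rewrite /= EFin_max gt_max => /andP[].
Qed.

Lemma survival_rect_measurable s : survival_rect s `<=` measurable.
Proof.
move=> _ [B [u [mB us ->]]]; apply: measurableI.
  exact: (g_sigma_sub_measurable (gensX_itv_measurable hX s)).
by apply: fin_bigcap_measurable => // i _; exact: tau_gt_measurable.
Qed.

Lemma survival_rect_setT s : 0 <= s -> survival_rect s setT.
Proof.
move=> s0; exists setT, (fun=> -1); split.
- exact: (@measurableT _ (g_sigma_algebraType (gensX `[0, s]%classic))).
- by move=> i; apply: le_trans s0; rewrite oppr_le0.
- apply/esym/seteqP; split => // w _; split=> // i _ /=.
  case: htau => _ /(_ i w) tau0 _ _; apply: lt_le_trans tau0.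
  by rewrite lte_fin oppr_lt0.
Qed.

(** An event of [X] is a rectangle with all thresholds at [-1]; [tau i > u] is one with threshold
    [u] at [i] and [-1] elsewhere, and [Y] is 1 minus its indicator. *)
Lemma gensF_sub_survival_rect s : 0 <= s ->
  <<s gensF s >> `<=` <<s survival_rect s >>.
Proof.
move=> s0; apply: smallest_sub; first exact: smallest_sigma_algebra.
have pos i w : ((-1)%:E < tau i w)%E.
  case: htau => _ /(_ i w) tau0 _ _; apply: lt_le_trans tau0.
  by rewrite lte_fin oppr_lt0.
move=> _ [[[i|i] u] /= us [B mB <-]].
  apply: sub_sigma_algebra; exists (setT `&` (fun w => X u w i 0) @^-1` B), (fun=> -1).
  split.
  - exact: (process_measurable (fun (i : 'I_d) t w => X t w i 0)).
  - by move=> _; apply: le_trans s0; rewrite oppr_le0.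
  - by rewrite [RHS]setIidl// => w _ j _; exact: pos.
have tauS : <<s survival_rect s >> [set w | (u%:E < tau i w)%E].
  apply: sub_sigma_algebra; exists setT, (fun j => if j == i then u else -1); split.
  - exact: (@measurableT _ (g_sigma_algebraType (gensX `[0, s]%classic))).
  - move=> j; case: ifP => _; last by apply: le_trans s0; rewrite oppr_le0.
    by move: us; rewrite in_itv/= => /andP[].
  - rewrite setTI; apply/seteqP; split => w /=.
      by move=> uw j _ /=; case: eqP => [->//|_]; exact: pos.
    by move=> /(_ i I) /=; rewrite eqxx.
have := @g_sigma_measurable_indic R _ _ _ _ tauS.
move=> mI; have : measurable_fun setT ((fun w => (Y tau i u w)%:R) :
    g_sigma_algebraType (survival_rect s) -> R).
  rewrite (_ : (fun w => _) = fun w => 1 - \1_[set w | (u%:E < tau i w)%E] w).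
    by apply: measurable_funB => //; exact: measurable_cst.
  by apply/funext => w; rewrite Y_tau indicE mem_setE.
by apply.
Qed.

(* Since [u i <= s <= r], surviving until [r] replaces the threshold [u i] by [r]
   for [i] in [D] and leaves the other thresholds unchanged. *)
Lemma survival_rect_mul (D : {set 'I_n}) (B : set T) (u : 'I_n -> R) s r w :
  (forall i, u i <= s) -> s <= r ->
  \1_(B `&` \bigcap_i [set w | ((u i)%:E < tau i w)%E]) w * survival D r w =
  \1_B w * \1_(\bigcap_i [set w |
     ((if i \in D then r else u i)%:E < tau i w)%E]) w :> R.
Proof.
move=> us sr; rewrite indicI -mulrA; congr (_ * _).
have [wr|wr] := pselect ((\bigcap_i [set w |
    ((if i \in D then r else u i)%:E < tau i w)%E]) w).
  rewrite [RHS]indicE mem_set// indicE mem_set ?mul1r.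
    by rewrite /survival big1// => i iD; have /= := wr i I; rewrite iD => ->.
  move=> i _; have /= := wr i I; case: ifP => // _.
  by apply: le_lt_trans; rewrite lee_fin (le_trans (us i)).
rewrite [RHS]indicE memNset//.
have [wu|wu] := pselect ((\bigcap_i [set w | ((u i)%:E < tau i w)%E]) w); last first.
  by rewrite indicE memNset// mul0r.
have [i iD /negbTE ir] : exists2 i, i \in D & ~~ (r%:E < tau i w)%E.
  apply: contrapT => noi; apply: wr => i _ /=; case: ifP => iD; last exact: wu.
  by apply/negPn/negP => ir; apply: noi; exists i.
by rewrite /survival (bigD1 i)//= ir mul0r mulr0.
Qed.

(** Given the whole of [X], joint survival is a product of exponentials, tested here against [\1_B]
    times a coordinate of [X r]. The cumulated intensity up to [r] is split at [s]: the part before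
    [s] joins the test function, the increment is left to [feynman_kac]. *)
Lemma meanX_survival (D : {set 'I_n}) (B : set T) (u : 'I_n -> R) (s r : R) a :
  0 <= s -> s <= r -> <<s gensX `[0, s]%classic >> B -> (forall i, u i <= s) ->
  \int[P]_w (\1_(B `&` \bigcap_i [set w | ((u i)%:E < tau i w)%E]) w *
    (survival D r w * X r w a 0)) =
  meanX (P := P) (X := X) r (fun w => (\1_B w *
      (\prod_(i | i \notin D) expR (- cum_intensity lam X (u i) w)) *
      expR (- (#|D|%:R * cum_intensity lam X s w))) *
    expR (- (#|D|%:R * (cum_intensity lam X r w - cum_intensity lam X s w)))) a 0.
Proof.
move=> s0 sr mB us; have r0 := le_trans s0 sr.
have gX : gensX `[0, +oo[%classic `<=` measurable.
  by apply: (gensX_measurable hX) => v /=; rewrite in_itv/= andbT.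
have mK : measurable_fun setT ((fun w => \1_B w * X r w a 0) :
    g_sigma_algebraType (gensX `[0, +oo[%classic) -> R).
  apply: measurable_funM.
    apply: (@g_sigma_measurable_fun_sub _ _ _ (gensX `[0, s]%classic)).
      by apply: process_generators_sub => v /=; rewrite !in_itv/= => /andP[->].
    exact: g_sigma_measurable_indic.
  apply: (process_measurable (fun (i : 'I_d) t w => X t w i 0)).
  by rewrite /= in_itv/= r0.
have K01 w : 0 <= \1_B w * X r w a 0 <= 1.
  have /andP[? ?] := X_itv hX w a r0.
  rewrite indicE; case: (_ \in _); first by rewrite mul1r; apply/andP.
  by rewrite mul0r lexx ler01.
have := is_condexp_mul gX (joint_survival_condexp
  (fun i => if i \in D then r else u i)) mK K01.
rewrite mxE => /esym ce; transitivity (\int[P]_w (\1_B w * X r w a 0 *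
    \1_(\bigcap_i [set w |
      ((if i \in D then r else u i)%:E < tau i w)%E]) w)).
  by apply: eq_Rintegral => w _; rewrite mulrA (survival_rect_mul _ _ _ s)// mulrAC.
rewrite ce; apply: eq_Rintegral => w _; rewrite mulrAC; congr (_ * _).
rewrite [X in _ * X = _](prod_expR_thresholds D u r
  (fun v => cum_intensity lam X v w)).
move: (cum_intensity lam X r w) (cum_intensity lam X s w) => cr cs.
by rewrite -!mulrA -expRD mulrBr opprB addKr.
Qed.

(** It suffices to compare integrals over the rectangles. There [meanX_survival] at [r = t] and at
    [r = s] produces the same test function [K], and [feynman_kac] relates the two times. *)
Lemma survival_condexp (D : {set 'I_n}) s t a : 0 <= s -> s <= t ->
  is_condexp P (filtration X tau s) (fun w => survival D t w * X t w a 0)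
    (fun w => survival D s w *
       (expmx ((t - s) *: Qlam Q lam #|D|) *m X s w) a 0).
Proof.
move=> s0 st; have t0 := le_trans s0 st.
set E := expmx _.
have SXi r b : 0 <= r ->
    P.-integrable setT (EFin \o (fun w => survival D r w * X r w b 0)).
  move=> r0; apply: (bounded_mulX_integrable hX) => //.
    exact: survival_measurableT.
  by move=> w; exact: survival_itv.
have ZE : (fun w => survival D s w * (E *m X s w) a 0) =
    fun w => \sum_b E a b * (survival D s w * X s w b 0).
  apply/funext => w; rewrite mxE mulr_sumr; apply: eq_bigr => b _.
  by rewrite mulrCA.
have ESXi b : P.-integrable setT
    (EFin \o (fun w => E a b * (survival D s w * X s w b 0))).
  exact: (integrableZl _ (E a b) (SXi s b s0)).
have Zi : P.-integrable setT (EFin \o (fun w => survival D s w * (E *m X s w) a 0)).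
  rewrite ZE (_ : _ \o _ = fun w => (\sum_b (E a b * (survival D s w * X s w b 0))%:E)%E).
    by apply: integrable_sum => // b _; exact: ESXi.
  by apply/funext => w /=; rewrite sumEFin.
apply/is_condexpP; first exact: gensF_measurable.
split=> //; first exact: SXi.
  rewrite ZE; apply: measurable_sum => b; apply: measurable_funM; first exact: measurable_cst.
  apply: measurable_funM; first exact: survival_measurable.
  apply: (process_measurable (fun z : 'I_d + 'I_n => match z with
    | inl i => fun t w => X t w i 0
    | inr i => fun t w => (Y tau i t w)%:R
    end) _ (inl b)).
  by rewrite /= in_itv/= s0 lexx.
move=> A /(gensF_sub_survival_rect _ s0) mA.
have indi (A' : set T) (F : T -> R) : measurable A' ->
    P.-integrable setT (EFin \o F) ->
    P.-integrable setT (EFin \o (fun w => \1_A' w * F w)).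
  move=> mA' Fi; apply: (@integrableM_bounded _ _ _ _ _ _ 1) => //.
  by move=> w; rewrite indicE normr_nat lern1 leq_b1.
have diffi : P.-integrable setT (EFin \o (fun w =>
    survival D s w * (E *m X s w) a 0 - survival D t w * X t w a 0)).
  exact: (integrableB _ Zi (SXi t a t0)).
have diffE A' : measurable A' -> \int[P]_w (\1_A' w *
    (survival D s w * (E *m X s w) a 0 - survival D t w * X t w a 0)) =
    \int[P]_w (\1_A' w * (survival D s w * (E *m X s w) a 0)) -
    \int[P]_w (\1_A' w * (survival D t w * X t w a 0)).
  move=> mA'; rewrite -RintegralB//; [|exact: indi|by apply: indi => //; exact: SXi].
  by apply: eq_Rintegral => w _; rewrite mulrBr.
have mA' : measurable A := g_sigma_sub_measurable (survival_rect_measurable s) _ mA.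
(* The pi-system argument concerns vanishing integrals, hence is applied to the difference. *)
apply/eqP; rewrite -subr_eq0 -diffE//; apply/eqP.
apply: (Rintegral_pi_system _ _ (survival_rect_setI s) (survival_rect_measurable s)
  (survival_rect_setT s s0) diffi _ A mA) => _ [B [u [mB us ->]]].
have mR : measurable (B `&` \bigcap_i [set w | ((u i)%:E < tau i w)%E]).
  by apply: (survival_rect_measurable s); exists B, u.
rewrite diffE//; apply/eqP; rewrite subr_eq0; apply/eqP.
rewrite (meanX_survival D B u s t a s0 st mB us).
(* The part of the weight in [meanX_survival] that does not involve [r]. As the [u i] are at most
   [s], it is measurable with respect to the past of [X] up to [s]. *)
pose K w : R := \1_B w *
  (\prod_(i | i \notin D) expR (- cum_intensity lam X (u i) w)) *
  expR (- (#|D|%:R * cum_intensity lam X s w)).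
have mK : measurable_fun setT (K : g_sigma_algebraType (gensX `[0, s]%classic) -> R).
  have mcum v : v <= s -> measurable_fun setT
      (cum_intensity lam X v : g_sigma_algebraType (gensX `[0, s]%classic) -> R).
    move=> vs; apply: (cum_intensity_measurable hlam hX) => x /=.
    by rewrite !in_itv/= => /andP[-> xv]; rewrite (le_trans xv).
  apply: measurable_funM; first apply: measurable_funM.
  - exact: g_sigma_measurable_indic.
  - rewrite [X in measurable_fun _ X](_ : _ = fun w =>
        \prod_(i <- enum (~: D)) expR (- cum_intensity lam X (u i) w)); last first.
      by apply/funext => w; rewrite big_enum; apply: eq_bigl => i; rewrite inE.
    apply: measurable_prod => i _; apply: measurableT_comp => //.
    by apply: measurable_funN; exact: mcum.
  - apply: measurableT_comp => //; apply: measurable_funN.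
    by apply: measurable_funM; [exact: measurable_cst|exact: mcum].
have K01 w : 0 <= K w <= 1.
  have e01 x : 0 <= x -> 0 <= expR (- x) <= 1.
    by move=> x0; rewrite expR_ge0 expR_le1 oppr_le0.
  have /andP[i0 i1] : 0 <= (\1_B w : R) <= 1.
    by rewrite indicE; case: (_ \in _); rewrite lexx ler01.
  have /andP[p0 p1] : 0 <= \prod_(i | i \notin D)
      expR (- cum_intensity lam X (u i) w) <= 1.
    rewrite prodr_ge0; last by move=> i _; exact: expR_ge0.
    by apply: prodr_ile1 => i _; apply: e01; exact: (cum_intensity_ge0 hlam hX).
  have /andP[q0 q1] : 0 <= expR (- (#|D|%:R * cum_intensity lam X s w)) <= 1.
    by apply: e01; rewrite mulr_ge0// (cum_intensity_ge0 hlam hX).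
  by rewrite !mulr_ge0// !mulr_ile1// mulr_ge0.
rewrite (feynman_kac hlam hX #|D| s0 st mK K01) -/E mxE.
transitivity (\int[P]_w (\sum_b E a b *
    (\1_(B `&` \bigcap_i [set w | ((u i)%:E < tau i w)%E]) w *
      (survival D s w * X s w b 0)))).
  apply: eq_Rintegral => w _; rewrite mxE !mulr_sumr; apply: eq_bigr => b _.
  by ring.
have Ii b := indi _ _ mR (SXi s b s0).
rewrite Rintegral_sum//; last first.
  by move=> b; exact: (integrableZl _ (E a b) (Ii b)).
apply: eq_bigr => b _; rewrite RintegralZl//; congr (_ * _).
rewrite (meanX_survival D B u s s b s0 (lexx s) mB us) [LHS]mxE [RHS]mxE.
apply: eq_Rintegral => w _.
by rewrite subrr mulr0 oppr0 expR0 mulr1.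
Qed.

End DefaultTimes.

(** * Binomial inversion *)

(** Both products are the trinomial coefficient [(a + b + c)! / (a! b! c!)]. *)
Lemma bin_trinomial a b c :
  ('C(a + b + c, b + c) * 'C(b + c, b) = 'C(a + b, b) * 'C(a + b + c, a + b))%N.
Proof.
have fE x y : ('C(x + y, y) * (x`! * y`!) = (x + y)`!)%N.
  by rewrite -(bin_fact (leq_addl x y)) addnK [(y`! * _)%N]mulnC.
have fE' x y : ('C(x + y, x) * (x`! * y`!) = (x + y)`!)%N.
  by rewrite addnC [(x`! * _)%N]mulnC fE.
have f0 : (0 < a`! * b`! * c`!)%N by rewrite !muln_gt0 !fact_gt0.
apply/eqP; rewrite -(eqn_pmul2r f0); apply/eqP.
transitivity ((a + b + c)`!).
  by rewrite -addnA -[RHS]fE -[(b + c)`!]fE'; ring.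
by rewrite -[LHS]fE' -[(a + b)`!]fE; ring.
Qed.

(** For [j <= i] this is [bin_trinomial] with [a = n - k], [b = k - i], [c = i - j]; for [i < j]
    both sides vanish. It trades the coefficients of the final formula for the number of surviving
    subsets of size [n - i]. *)
Lemma bin_survivors n k i j : (i <= k)%N -> (j <= k)%N -> (k <= n)%N ->
  ('C(n - j, k - j) * 'C(k - j, k - i) = 'C(n - i, k - i) * 'C(n - j, n - i))%N.
Proof.
move=> ik jk kn; have [ij|ji] := ltnP i j.
  have -> : 'C(k - j, k - i) = 0%N by apply: bin_small; lia.
  have -> : 'C(n - j, n - i) = 0%N by apply: bin_small; lia.
  by rewrite !muln0.
have := bin_trinomial (n - k) (k - i) (i - j).
have -> : (n - k + (k - i) + (i - j) = n - j)%N by lia.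
have -> : (k - i + (i - j) = k - j)%N by lia.
by have -> : (n - k + (k - i) = n - i)%N by lia.
Qed.

(** Only [l = j] contributes. If [j > k] there is no such index, and on the right ['C(n - j, n - i)]
    is 0. *)
Lemma sum_bin_survivors (R : pzRingType) n k i j :
  (i <= k)%N -> (j <= n)%N -> (k <= n)%N ->
  \sum_(l < k.+1) (j == l)%:R * ('C(n - l, k - l) * 'C(k - l, k - i))%:R =
  ('C(n - i, k - i) * 'C(n - j, n - i))%:R :> R.
Proof.
move=> ik jn kn; have [jk|kj] := leqP j k.
  rewrite (bigD1 (Ordinal (jk : j < k.+1)%N))//= [j == _](eqxx j) mul1r bin_survivors//.
  rewrite big1 ?addr0// => l /eqP lj; case: eqP => [jl|_]; last by rewrite mul0r.
  by case: lj; apply: ord_inj; rewrite /= jl.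
rewrite big1 => [|l _]; last first.
  by case: eqP => [jl|_]; [move: kj; rewrite jl ltnNge -ltnS ltn_ord|rewrite mul0r].
have -> : 'C(n - j, n - i) = 0%N by apply: bin_small; lia.
by rewrite muln0.
Qed.

(** The binomial theorem for [(-1 + 1) ^ m], padded by zero terms for [l > m]. *)
Lemma sum_sign_bin (R : pzRingType) (k m : nat) : (m <= k)%N ->
  \sum_(l < k.+1) (-1) ^+ l * 'C(m, l)%:R = (m == 0%N)%:R :> R.
Proof.
move=> mk; transitivity ((-1 + 1 : R) ^+ m); last by rewrite addNr expr0n.
rewrite exprD1n (big_ord_widen k.+1 (fun l => (-1) ^+ l *+ 'C(m, l)))//.
rewrite [RHS]big_mkcond/=; apply: eq_bigr => l _; rewrite ltnS mulr_natr.
by case: leqP => // ml; rewrite bin_small.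
Qed.

(** Recovers the indicator of [j = k] from the counts ['C(n - j, n - i)]. For [j <= k],
    [bin_survivors] lets ['C(n - j, k - j)] factor out, leaving an alternating row sum of Pascal's
    triangle, which vanishes unless [j = k]. *)
Lemma bin_inversion (R : pzRingType) n k j : (j <= n)%N -> (k <= n)%N ->
  \sum_(i < k.+1) (-1) ^+ (k - i) *
    ('C(n - i, k - i) * 'C(n - j, n - i))%:R = (j == k)%:R :> R.
Proof.
move=> jn kn; have [jk|kj] := leqP j k; last first.
  rewrite big1 => [|i _].
    by case: eqP kj => // ->; rewrite ltnn.
  have -> : 'C(n - j, n - i) = 0%N by apply: bin_small; have := ltn_ord i; lia.
  by rewrite muln0 mulr0.
rewrite (eq_bigr (fun i : 'I_k.+1 =>
    'C(n - j, k - j)%:R * ((-1) ^+ (k - i) * 'C(k - j, k - i)%:R))); last first.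
  move=> i _; rewrite -bin_survivors// ?natrM; last by rewrite -ltnS.
  by rewrite mulrA -commr_sign mulrA.
rewrite -mulr_sumr (reindex_inj rev_ord_inj)/=.
rewrite (eq_bigr (fun l : 'I_k.+1 => (-1) ^+ l * 'C(k - j, l)%:R)); last first.
  by move=> l _; rewrite subSS subKn// -ltnS.
rewrite sum_sign_bin ?leq_subr// subn_eq0.
have [kj|kj] := leqP k j; last by rewrite mulr0; case: eqP kj => // ->; rewrite ltnn.
have -> : j = k by apply/eqP; rewrite eqn_leq jk.
by rewrite eqxx subnn bin0 mulr1.
Qed.

(** Both sides count the subsets of size [m] of the set [S] of survivors, since [survival D] is the
    indicator of [D \subset S]. *)
Lemma sum_survival (R : realType) (disp : measure_display)
    (T : measurableType disp) (n m : nat)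
    (tau : 'I_n -> T -> \bar R) t w :
  \sum_(D : {set 'I_n} | #|D| == m) survival (tau := tau) D t w =
  'C(n - N tau t w, m)%:R :> R.
Proof.
pose S := [set i | (t%:E < tau i w)%E]%SET.
have -> : (n - N tau t w)%N = #|S|.
  rewrite /N (eq_bigr (fun i => nat_of_bool (i \in ~: S))); last first.
    by move=> i _; rewrite /Y !inE leNgt.
  rewrite -big_mkcond sum1_card.
  by rewrite -[X in (X - _)%N](card_ord n) -(cardsC S) addnK.
have sE D : survival (tau := tau) D t w = (D \subset S)%:R.
  rewrite /survival; case: (boolP (D \subset S)).
    move=> /fintype.subsetP DS.
    by apply: big1 => i /DS; rewrite inE => ->.
  move=> /subsetPn[i iD iS].
  by rewrite (bigD1 i)//=; move: iS; rewrite inE => /negbTE->; rewrite mul0r.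
rewrite (eq_bigr _ (fun D _ => sE D)) -cards_draws -sum1_card natr_sum.
rewrite [LHS]big_mkcond [RHS]big_mkcond; apply: eq_bigr => D _.
by rewrite inE; case: (D \subset S); case: (#|D| == m).
Qed.

Lemma N_le (R : realType) (disp : measure_display) (T : measurableType disp)
    (n : nat) (tau : 'I_n -> T -> \bar R) t w : (N tau t w <= n)%N.
Proof.
rewrite /N; apply: (@leq_trans (\sum_(i < n) 1)); last by rewrite sum1_card card_ord.
by apply: leq_sum => i _; rewrite /Y leq_b1.
Qed.

(** * Combination of the survival identities *)

Theorem proposition2p11 (R : realType) (disp : measure_display)
    (T : measurableType disp) (P : probability T R) (d n : nat)
    (Q : 'M[R]_d) (lam : 'cV[R]_d)
    (X : R -> T -> 'cV[R]_d) (tau : 'I_n -> T -> \bar R)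
    (hQ : intensity_matrix Q) (hirr : irreducible_intensity Q)
    (hlam : forall i, 0 <= lam i 0)
    (hX : markov_chain P Q X) (htau : default_times P lam X tau)
    (s t : R) (hs : 0 <= s) (hst : s <= t) (k : nat) (hk : (k <= n)%N) :
  is_condexp_cV P (filtration X tau s) (zeta X tau k t)
    (fun w => \sum_(j < k.+1) 'C(n - j, k - j)%:R *:
       ((\sum_(i < k.+1) ((-1) ^+ (k - i) * 'C(k - j, k - i)%:R) *:
           expmx ((t - s) *: Qlam Q lam (n - i))) *m zeta X tau j s w)).
Proof.
move=> a.
pose E m := expmx ((t - s) *: Qlam Q lam m).
(* Indexing by pairs [(i, D)] yields one finite sum, as [is_condexp_sum] requires; the test on the
   size retains the sets with [n - i] elements. *)
pose c (p : 'I_k.+1 * {set 'I_n}) : R := (#|p.2| == (n - p.1)%N)%:R *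
  ((-1) ^+ (k - p.1) * 'C(n - p.1, k - p.1)%:R).
have sumE r w (F : nat -> R) :
    \sum_p c p * (survival (tau := tau) p.2 r w * F #|p.2|) =
    \sum_(i < k.+1) (-1) ^+ (k - i) *
      ('C(n - i, k - i) * 'C(n - N tau r w, n - i))%:R * F (n - i)%N.
  rewrite -(pair_bigA _ (fun i D => c (i, D) *
    (survival (tau := tau) D r w * F #|D|)))/=.
  apply: eq_bigr => i _; rewrite natrM -sum_survival mulrA mulr_sumr mulr_suml.
  rewrite [RHS]big_mkcond; apply: eq_bigr => D _; rewrite /c/=.
  by case: eqP => [->|_]; rewrite ?mul0r// mul1r !mulrA.
have := is_condexp_sum _ _ (index_enum ('I_k.+1 * {set 'I_n})%type) c
  (fun p w => survival (tau := tau) p.2 t w * X t w a 0)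
  (fun p w => survival (tau := tau) p.2 s w * (E #|p.2| *m X s w) a 0)
  (gensF_measurable hX htau s)
  (fun p => survival_condexp hlam hX htau p.2 s t a hs hst).
congr is_condexp; apply/funext => w.
  (* At time [t] the vector [X] does not depend on [i], so the inversion yields the indicator of
     [N = k]. *)
  rewrite (sumE t w (fun=> X t w a 0)) -mulr_suml bin_inversion ?N_le//.
  by rewrite /zeta mxE.
rewrite (sumE s w (fun m => (E m *m X s w) a 0)) summxE.
(* At time [s] the exponential depends on [i], so the sum over [i] stays. The index [j] enters
   through [sum_bin_survivors], with only [j = N] at time [s] contributing. *)
transitivity (\sum_(j < k.+1) \sum_(i < k.+1)
    (-1) ^+ (k - i) * ((N tau s w == j)%:R *
      ('C(n - j, k - j) * 'C(k - j, k - i))%:R) * (E (n - i)%N *m X s w) a 0).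
  rewrite exchange_big; apply: eq_bigr => i _.
  rewrite -mulr_suml -mulr_sumr sum_bin_survivors ?N_le//.
  by rewrite -ltnS.
apply: eq_bigr => j _; rewrite mxE mulmx_suml summxE mulr_sumr.
apply: eq_bigr => i _; rewrite -scalemxAl /zeta -scalemxAr !mxE natrM -/(E _).
by ring.
Qed.
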